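(* Let $n\in\mathbb{N}$, let $X_1,\dots,X_n$, $Y_1,\dots,Y_n$ be real-valued random variables with distributions $F_1,\dots,F_n$, $G_1,\dots,G_n$, and let $\Theta_1,\dots,\Theta_n,\Delta_1,\dots,\Delta_n$ be non-negative, non-degenerate to zero random variables, independent of $X_1,\dots,X_n,Y_1,\dots,Y_n$ and satisfying Assumption A. Consider the following two sets of conditions. (H1) $\{X_1,\dots,X_n\}$, $\{Y_1,\dots,Y_n\}$ are GQAI and $(X_i,Y_j)\in\mathcal{C}^{(2)}$ for all $i,j=1,\dots,n$. (H2) $\{X_1,\dots,X_n\}$, $\{Y_1,\dots,Y_n\}$ are GTAI; $X_1,\dots,X_n$ are TAI; $Y_1,\dots,Y_n$ are TAI; $(X_i,Y_j)\in(\mathcal{D}\cap\mathcal{L})^{(2)}$ for all $i,j=1,\dots,n$; for every $i$, $\mathbf{E}[\Theta_i^p]<\infty$ for some $p>\max_{1\le i\le n}J_{F_i}^+$; and for every $j$, $\mathbf{E}[\Delta_j^q]<\infty$ for some $q>\max_{1\le j\le n}J_{G_j}^+$. (i) If (H1) or (H2) holds, then, as $x\wedge y\to\infty$, $$\psi_{and}^{\Theta,\Delta}(x,y;n)\sim\sum_{i=1}^n\sum_{j=1}^n\mathbf{P}[\Theta_iX_i>x,\,\Delta_jY_j>y].$$ (ii) Suppose that (H1) or (H2) holds with the condition on the class of $(X_i,Y_j)$ replaced by: $F_i\in\mathcal{R}_{-\alpha_{1i}}$, $G_j\in\mathcal{R}_{-\alpha_{2j}}$ and $(X_i,Y_j)\in\mathcal{R}^{(2)}_{(-\alpha_{1i},-\alpha_{2j})}$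 with $0<\alpha_{1i},\alpha_{2j}<\infty$, for all $i,j=1,\dots,n$. Suppose additionally that for some $\varepsilon>0$, $\mathbf{E}[\Theta_i^{\alpha_{1i}+\varepsilon}\Delta_j^{\alpha_{2j}+\varepsilon}]<\infty$ for all $i,j=1,\dots,n$. Then, as $x\wedge y\to\infty$, $$\psi_{and}^{\Theta,\Delta}(x,y;n)\sim\sum_{i=1}^n\sum_{j=1}^n\mathbf{E}[\Theta_i^{\alpha_{1i}}\Delta_j^{\alpha_{2j}}]\,\mathbf{P}[X_i>x,\,Y_j>y].$$
   Context: Ruin probability: for initial surpluses $x,y$ and $k=1,\dots,n$, let $U_1^\Theta(k,x)=x-\sum_{i=1}^k\Theta_iX_i$ and $U_2^\Delta(k,y)=y-\sum_{j=1}^k\Delta_jY_j$ be the surplus processes (equal to $x$, $y$ at time $0$). Let $\tau_1^\Theta(x)=\inf\{k\in\{1,\dots,n\}:U_1^\Theta(k,x)<0\}$, $\tau_2^\Delta(y)=\inf\{k\in\{1,\dots,n\}:U_2^\Delta(k,y)<0\}$ (with $\inf\emptyset=\infty$), $\tau_{and}^{\Theta,\Delta}=\max\{\tau_1^\Theta(x),\tau_2^\Delta(y)\}$ and $$\psi_{and}^{\Theta,\Delta}(x,y;n)=\mathbf{P}[\tau_{and}^{\Theta,\Delta}\le n]=\mathbf{P}\Big[\max_{1\le k\le n}\sum_{i=1}^k\Theta_iX_i>x,\ \max_{1\le l\le n}\sum_{j=1}^l\Delta_jY_j>y\Big].$$ Notation: $x\wedge y=\min\{x,y\}$; for positive functions,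 $f\sim g$ means $f/g\to1$ and $f=o(g)$ means $f/g\to0$ in the indicated limit. $\overline F=1-F$; all distributions of the $X_i$, $Y_j$ satisfy $\overline F(x)>0$ for all $x\in\mathbb{R}$. Ratios, conditional probabilities and $o$-relations involving joint tails presuppose that the joint tail in the denominator is positive. ''Independent of'' means the vector of all $\Theta_i,\Delta_j$ is independent of the vector of all $X_i,Y_j$. ''Non-degenerate to zero'' means not almost surely equal to $0$. One-dimensional classes: $F\in\mathcal{L}$ if $\lim_{x\to\infty}\overline F(x-a)/\overline F(x)=1$ for all $a>0$; $F\in\mathcal{D}$ if $\limsup_{x\to\infty}\overline F(bx)/\overline F(x)<\infty$ for all $b\in(0,1)$; $F\in\mathcal{C}$ if $\lim_{z\uparrow1}\limsup_{x\to\infty}\overline F(zx)/\overline F(x)=1$; $F\in\mathcal{R}_{-\alpha}$ ($\alpha>0$) if $\lim_{x\to\infty}\overline F(tx)/\overline F(x)=t^{-\alpha}$ for all $t>0$. Two-dimensional classes, for a random pair $(X,Y)$ with marginal distributions $F,G$: - $(X,Y)\in\mathcal{L}^{(2)}$ if $F,G\in\mathcal{L}$ and $\lim_{x\wedge y\to\infty}\mathbf{P}[X>x-a_1,Y>y-a_2]/\mathbf{P}[X>x,Y>y]=1$ for all $(a_1,a_2)\in[0,\infty)^2\setminus\{(0,0)\}$. - $(X,Y)\in\mathcal{D}^{(2)}$ if $F,G\in\mathcal{D}$ and $\limsup_{x\wedge y\to\infty}\mathbf{P}[X>b_1x,Y>b_2y]/\mathbf{P}[X>x,Y>y]<\infty$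 for all $(b_1,b_2)\in(0,1)^2$. - $(\mathcal{D}\cap\mathcal{L})^{(2)}=\mathcal{D}^{(2)}\cap\mathcal{L}^{(2)}$. - $(X,Y)\in\mathcal{C}^{(2)}$ if $F,G\in\mathcal{C}$ and $\lim_{(z_1,z_2)\uparrow(1,1)}\limsup_{x\wedge y\to\infty}\mathbf{P}[X>z_1x,Y>z_2y]/\mathbf{P}[X>x,Y>y]=1$. - $(X,Y)\in\mathcal{R}^{(2)}_{(-\alpha_1,-\alpha_2)}$ if $F\in\mathcal{R}_{-\alpha_1}$, $G\in\mathcal{R}_{-\alpha_2}$ and $\lim_{x\wedge y\to\infty}\mathbf{P}[X>t_1x,Y>t_2y]/\mathbf{P}[X>x,Y>y]=t_1^{-\alpha_1}t_2^{-\alpha_2}$ for all $t_1,t_2>0$. Upper Matuszewska index: $J_F^+=-\lim_{v\to\infty}\log\overline F_*(v)/\log v$, where $\overline F_*(v)=\liminf_{x\to\infty}\overline F(vx)/\overline F(x)$, $v>1$. TAI: $X_1,\dots,X_n$ are tail asymptotically independent if $\lim_{x_i\wedge x_j\to\infty}\mathbf{P}[|X_i|>x_i\mid X_j>x_j]=0$ for all $i\neq j$. GTAI: $\{X_1,\dots,X_n\}$, $\{Y_1,\dots,Y_n\}$ are GTAI if $\lim_{x_i\wedge x_k\wedge y_j\to\infty}\mathbf{P}[|X_i|>x_i\mid X_k>x_k,Y_j>y_j]=0$ for all $i\neq k$ and all $j$, and $\lim_{x_i\wedge y_k\wedge y_j\to\infty}\mathbf{P}[|Y_j|>y_j\mid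 Y_k>y_k,X_i>x_i]=0$ for all $j\neq k$ and all $i$. GQAI: $\{X_1,\dots,X_n\}$, $\{Y_1,\dots,Y_n\}$ are GQAI if $$\lim_{x\wedge y\to\infty}\frac{\mathbf{P}[|X_i|>x,X_k>x,Y_j>y]}{\mathbf{P}[X_i>x,Y_j>y]+\mathbf{P}[X_k>x,Y_j>y]}=0$$ for all $i\neq k$ and all $j$, and $$\lim_{x\wedge y\to\infty}\frac{\mathbf{P}[|Y_j|>y,Y_k>y,X_i>x]}{\mathbf{P}[X_i>x,Y_j>y]+\mathbf{P}[X_i>x,Y_k>y]}=0$$ for all $j\neq k$ and all $i$. Assumption A: there exist functions $b_i,c_j:[0,\infty)\to(0,\infty)$ ($i,j=1,\dots,n$) with $b_i(x)\to\infty$, $b_i(x)=o(x)$ as $x\to\infty$, $c_j(y)\to\infty$, $c_j(y)=o(y)$ as $y\to\infty$, such that for all $i,j$, as $x\wedge y\to\infty$, $\mathbf{P}[\Theta_i>b_i(x)]=o(\mathbf{P}[\Theta_iX_i>x,\Delta_jY_j>y])$ and $\mathbf{P}[\Delta_j>c_j(y)]=o(\mathbf{P}[\Theta_iX_i>x,\Delta_jY_j>y])$. *)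

(* Defs.v *)
From HB Require Import structures.
From mathcomp Require Export all_boot all_order all_algebra.
From mathcomp Require Export all_classical all_reals all_analysis.
Export Order.TTheory GRing.Theory Num.Theory.
Export numFieldNormedType.Exports.

Set Implicit Arguments.
Unset Strict Implicit.
Unset Printing Implicit Defensive.

Local Open Scope classical_set_scope.
Local Open Scope ring_scope.

Definition Pr d (T : measurableType d) (R : realType) (P : probability T R)
  (A : set T) : R := fine (P A).

(* The limit [x `&` y --> +oo]: the sets [x > M, y > M] form a basis of the
   product filter. *)
Notation oo2 R := (filter_prod (pinfty_nbhs R) (pinfty_nbhs R)).
Notation oo3 R := (filter_prod (oo2 R) (pinfty_nbhs R)).

(* Division by 0 is total, so the standing convention that the denominators
   of ratios, conditional probabilities and o-relations are positive in the
   limit is made explicit here and in the two-dimensional classes below. *)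
Definition ratio_cvg (R : realType) (S : Type) (F : set_system S)
    (f g : S -> R) (l : R) : Prop :=
  (\forall z \near F, 0 < g z) /\ (f z / g z @[z --> F] --> l).

Definition asymp_equiv (R : realType) (S : Type) (F : set_system S)
    (f g : S -> R) : Prop := ratio_cvg F f g 1.

Definition little_o (R : realType) (S : Type) (F : set_system S)
    (f g : S -> R) : Prop := ratio_cvg F f g 0.

Definition tail d (T : measurableType d) (R : realType) (P : probability T R)
  (X : {RV P >-> R}) (x : R) : R := fine (ccdf X x).
Arguments tail {d T R} P X x.

Definition jtail d (T : measurableType d) (R : realType) (P : probability T R)
  (X Y : T -> R) (x y : R) : R := Pr P [set t | X t > x /\ Y t > y].

(* The one-dimensional classes are properties of a survival function [Fb]. *)

Definition class_L (R : realType) (Fb : R -> R) : Prop :=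
  forall a : R, 0 < a ->
    ratio_cvg (pinfty_nbhs R) (fun x => Fb (x - a)) Fb 1.

Definition limsup_ratio (R : realType) (Fb : R -> R) (b : R) : \bar R :=
  limf_esup (fun x : R => (Fb (b * x) / Fb x)%:E) (pinfty_nbhs R).

Definition class_D (R : realType) (Fb : R -> R) : Prop :=
  forall b : R, 0 < b < 1 -> (limsup_ratio Fb b < +oo)%E.

Definition class_C (R : realType) (Fb : R -> R) : Prop :=
  limsup_ratio Fb z @[z --> (1 : R)^'-] --> (1 : \bar R)%E.

Definition class_R (R : realType) (alpha : R) (Fb : R -> R) : Prop :=
  forall t : R, 0 < t ->
    ratio_cvg (pinfty_nbhs R) (fun x => Fb (t * x)) Fb (t `^ (- alpha)).

(* Upper Matuszewska index; extended real, since [liminf_ratio] may vanish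
   ([lne 0 = -oo]). *)

Definition liminf_ratio (R : realType) (Fb : R -> R) (v : R) : \bar R :=
  limf_einf (fun x : R => (Fb (v * x) / Fb x)%:E) (pinfty_nbhs R).

Definition matuszewska (R : realType) (Fb : R -> R) : \bar R :=
  (- lim ((lne (liminf_ratio Fb v) * ((ln v)^-1)%:E) @[v --> pinfty_nbhs R]))%E.

Section pairs.
Context d (T : measurableType d) (R : realType) (P : probability T R).
Implicit Types X Y : {RV P >-> R}.

Definition class_L2 X Y : Prop :=
  [/\ class_L (tail P X), class_L (tail P Y) &
    forall a1 a2 : R, 0 <= a1 -> 0 <= a2 -> (a1, a2) != (0, 0) ->
      ratio_cvg (oo2 R) (fun z => jtail P X Y (z.1 - a1) (z.2 - a2))
        (fun z => jtail P X Y z.1 z.2) 1].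

Definition jtail_pos X Y : Prop :=
  \forall z \near oo2 R, 0 < jtail P X Y z.1 z.2.

Definition limsup_ratio2 X Y (b : R * R) : \bar R :=
  limf_esup (fun z : R * R =>
    (jtail P X Y (b.1 * z.1) (b.2 * z.2) / jtail P X Y z.1 z.2)%:E) (oo2 R).

Definition class_D2 X Y : Prop :=
  [/\ class_D (tail P X), class_D (tail P Y), jtail_pos X Y &
    forall b : R * R, 0 < b.1 < 1 -> 0 < b.2 < 1 ->
      (limsup_ratio2 X Y b < +oo)%E].

Definition class_DL2 X Y : Prop := class_D2 X Y /\ class_L2 X Y.

Definition class_C2 X Y : Prop :=
  [/\ class_C (tail P X), class_C (tail P Y), jtail_pos X Y &
    limsup_ratio2 X Y z
      @[z --> filter_prod (1 : R)^'- (1 : R)^'-] --> (1 : \bar R)%E].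

Definition class_R2 (alpha1 alpha2 : R) X Y : Prop :=
  [/\ class_R alpha1 (tail P X), class_R alpha2 (tail P Y) &
    forall t1 t2 : R, 0 < t1 -> 0 < t2 ->
      ratio_cvg (oo2 R) (fun z => jtail P X Y (t1 * z.1) (t2 * z.2))
        (fun z => jtail P X Y z.1 z.2) (t1 `^ (- alpha1) * t2 `^ (- alpha2))].

End pairs.
Arguments class_L2 {d T R} P X Y.
Arguments class_D2 {d T R} P X Y.
Arguments class_DL2 {d T R} P X Y.
Arguments class_C2 {d T R} P X Y.
Arguments class_R2 {d T R} P alpha1 alpha2 X Y.

Section families.
Context d (T : measurableType d) (R : realType) (P : probability T R).
Context (n : nat).
Implicit Types X Y Theta Delta : 'I_n -> {RV P >-> R}.

Definition cond_prob_cvg0 (S : Type) (F : set_system S) (A B : S -> set T)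
    : Prop :=
  ratio_cvg F (fun z => Pr P (A z `&` B z)) (fun z => Pr P (B z)) 0.

Definition TAI X : Prop :=
  forall i j, i != j ->
    cond_prob_cvg0 (oo2 R) (fun z => [set t | `|X i t| > z.1])
      (fun z => [set t | X j t > z.2]).

Definition GTAI_half X Y : Prop :=
  forall i k j, i != k ->
    cond_prob_cvg0 (oo3 R) (fun z => [set t | `|X i t| > z.1.1])
      (fun z => [set t | X k t > z.1.2 /\ Y j t > z.2]).

Definition GTAI X Y : Prop := GTAI_half X Y /\ GTAI_half Y X.

Definition GQAI X Y : Prop :=
  (forall i k j, i != k ->
    ratio_cvg (oo2 R)
      (fun z => Pr P [set t | [/\ `|X i t| > z.1, X k t > z.1 & Y j t > z.2]])
      (fun z => jtail P (X i) (Y j) z.1 z.2 + jtail P (X k) (Y j) z.1 z.2) 0)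
  /\
  (forall i k j, j != k ->
    ratio_cvg (oo2 R)
      (fun z => Pr P [set t | [/\ `|Y j t| > z.2, Y k t > z.2 & X i t > z.1]])
      (fun z => jtail P (X i) (Y j) z.1 z.2 + jtail P (X i) (Y k) z.1 z.2) 0).

Definition joint_vector X Y (t : T) : n.-tuple R * n.-tuple R :=
  ([tuple X i t | i < n], [tuple Y i t | i < n]).

Definition independent_vectors Theta Delta X Y : Prop :=
  forall A B : set (n.-tuple R * n.-tuple R), measurable A -> measurable B ->
    P (joint_vector Theta Delta @^-1` A `&` joint_vector X Y @^-1` B) =
    (P (joint_vector Theta Delta @^-1` A) * P (joint_vector X Y @^-1` B))%E.

(* The values of [b i] and [c j] on negative arguments are irrelevant. *)
Definition assumption_A Theta Delta X Y : Prop :=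
  exists b c : 'I_n -> R -> R,
    [/\ forall i, [/\ forall x : R, 0 <= x -> 0 < b i x,
          b i x @[x --> pinfty_nbhs R] --> pinfty_nbhs R &
          little_o (pinfty_nbhs R) (b i) id],
        forall j, [/\ forall y : R, 0 <= y -> 0 < c j y,
          c j y @[y --> pinfty_nbhs R] --> pinfty_nbhs R &
          little_o (pinfty_nbhs R) (c j) id] &
        forall i j,
          little_o (oo2 R) (fun z => tail P (Theta i) (b i z.1))
            (fun z => jtail P (Theta i \* X i) (Delta j \* Y j) z.1 z.2) /\
          little_o (oo2 R) (fun z => tail P (Delta j) (c j z.2))
            (fun z => jtail P (Theta i \* X i) (Delta j \* Y j) z.1 z.2)].

(* 0-based indices: the first [k] claims are those of index [i < k]. *)
Definition surplus Theta X (k : nat) (x : R) (t : T) : R :=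
  x - \sum_(i < n | (i < k)%N) Theta i t * X i t.

Definition ruin_time Theta X (x : R) (t : T) : \bar R :=
  ereal_inf [set k%:R%:E | k in
    [set k : nat | (1 <= k <= n)%N /\ surplus Theta X k x t < 0]].

Definition psi_and Theta Delta X Y (x y : R) : R :=
  Pr P [set t | (maxe (ruin_time Theta X x t) (ruin_time Delta Y y t)
                   <= n%:R%:E)%E].

Definition nondegenerate (Z : {RV P >-> R}) : Prop :=
  ~ {ae P, forall t, Z t = 0}.

(* The exponent p may depend on i, but exceeds the indices of all the [X k]. *)
Definition moment_cond Theta X : Prop :=
  forall i, exists2 p : R,
    (\big[maxe/-oo]_(k < n) matuszewska (tail P (X k)) < p%:E)%E &
    ('E_P[fun t => (Theta i t `^ p)%R] < +oo)%E.

(* K is a parameter because the same hypotheses are used with several class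
   conditions on the pairs (X i, Y j). *)
Definition cond_H1 X Y (K : Prop) : Prop := GQAI X Y /\ K.

Definition cond_H2 Theta Delta X Y (K : Prop) : Prop :=
  [/\ GTAI X Y, TAI X /\ TAI Y, K, moment_cond Theta X & moment_cond Delta Y].

End families.
Arguments TAI {d T R} P {n} X.
Arguments GTAI {d T R} P {n} X Y.
Arguments GQAI {d T R} P {n} X Y.
Arguments independent_vectors {d T R} P {n} Theta Delta X Y.
Arguments assumption_A {d T R} P {n} Theta Delta X Y.
Arguments psi_and {d T R} P {n} Theta Delta X Y x y.
Arguments nondegenerate {d T R} P Z.
Arguments moment_cond {d T R} P {n} Theta X.
Arguments cond_H1 {d T R} P {n} X Y K.
Arguments cond_H2 {d T R} P {n} Theta Delta X Y K.

(* Main.v *)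
Require Import Defs.
From HB Require Import structures.
From mathcomp Require Import measurable_realfun ring lra.

Set Implicit Arguments.
Unset Strict Implicit.
Unset Printing Implicit Defensive.

Local Open Scope classical_set_scope.
Local Open Scope ring_scope.

(** The decisive remark is that the conditions on the weights are uniform in the
    two thresholds. Assumption A bounds P[Theta_i > b_i(x)] by the joint tail
    A_ij(x, y) = P[Theta_i X_i > x, Delta_j Y_j > y] for all large x and y. With
    x fixed and y tending to infinity, the joint tail vanishes and the left-hand
    side does not change, so that it is zero: all the weights are almost surely
    bounded by a constant B ([assumption_A_bounded]).

    With bounded weights, A_ij is comparable, up to constants, with the joint
    tail H_ij of the claims X_i and Y_j. An upper bound comes from
    Theta_i X_i > x implying X_i > x / B, and a lower bound from the weights
    exceeding some h > 0 with positive probability ([weighted_tail_ge]);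
    dominated variation of H_ij absorbs the changes of scale
    ([tail_le_weighted]). Moreover the insensitivity of H_ij to small
    perturbations of the thresholds passes to A_ij by conditioning on the weights
    ([weighted_scale_insensitive], [weighted_shift_insensitive]).

    Ruin of both lines is then due to one big jump in each. Up to gaps l and m in
    the thresholds, the event is the disjoint union over (i, j) of the events
    that Theta_i X_i and Delta_j Y_j are the big jumps, except when a second term
    of the same line is of the order of the gap ([ruin_event_bounds]). The gaps
    must be small enough not to change A_ij asymptotically and large enough to
    make a second jump negligible ([ruin_asymp_of_gaps]). Under GTAI a large
    constant gap does, by long-tailedness ([ruin_asymp_GTAI]); under GQAI the gap
    is a small proportion of the threshold, by consistent variation
    ([ruin_asymp_GQAI]).

    For regularly varying tails, both insensitivities hold, and A_ij is
    equivalent to E[Theta_i^alpha1 Delta_j^alpha2] H_ij, by dominated convergence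
    of the conditional tails given the bounded weights
    ([weighted_tail_breiman]). *)

(** * Finite probabilities *)

Section finite_probability.
Context d (T : measurableType d) (R : realType) (P : probability T R).
Implicit Types A B : set T.

Lemma Pr_ge0 A : 0 <= Pr P A.
Proof. exact: fine_ge0. Qed.

Lemma PrE A : measurable A -> P A = (Pr P A)%:E.
Proof. by move=> mA; rewrite /Pr fineK// fin_num_measure. Qed.

Lemma Pr_le A B : measurable A -> measurable B -> A `<=` B -> Pr P A <= Pr P B.
Proof.
by move=> mA mB AB; rewrite -lee_fin -!PrE// le_measure// inE.
Qed.

Lemma Pr0 : Pr P set0 = 0.
Proof. by rewrite /Pr measure0. Qed.

Lemma Pr_setU_le A B : measurable A -> measurable B ->
  Pr P (A `|` B) <= Pr P A + Pr P B.
Proof.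
move=> mA mB; rewrite -lee_fin EFinD -!PrE//; first exact: measureU2.
exact: measurableU.
Qed.

Lemma Pr_setU A B : measurable A -> measurable B -> A `&` B = set0 ->
  Pr P (A `|` B) = Pr P A + Pr P B.
Proof.
move=> mA mB AB; apply: EFin_inj; rewrite EFinD -!PrE//.
  exact: measureU.
exact: measurableU.
Qed.

Lemma Pr_subset_setU A B C : measurable A -> measurable B -> measurable C ->
  A `<=` B `|` C -> Pr P A <= Pr P B + Pr P C.
Proof.
move=> mA mB mC ABC; apply: le_trans (Pr_setU_le mB mC).
by apply: Pr_le => //; exact: measurableU.
Qed.

Section finite_families.
Variables (I : finType) (F : I -> set T).
Hypothesis mF : forall i, measurable (F i).

Lemma measurable_exists (Q : pred I) :
  measurable [set t | exists2 i, Q i & F i t].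
Proof.
rewrite (_ : [set t | _] = \bigcup_(i in [set` Q]) F i)//.
by apply: fin_bigcup_measurable => //; exact: finite_finset.
Qed.

Let measurable_exists_seq (s : seq I) :
  measurable [set t | exists2 i, i \in s & F i t].
Proof. exact: measurable_exists. Qed.

Lemma Pr_exists_le (Q : pred I) :
  Pr P [set t | exists2 i, Q i & F i t] <= \sum_(i | Q i) Pr P (F i).
Proof.
rewrite -big_filter; set s := [seq i <- index_enum I | Q i].
have -> : [set t | exists2 i, Q i & F i t] = [set t | exists2 i, i \in s & F i t].
  apply/seteqP; split=> t [i Qi Fi]; exists i => //.
    by rewrite mem_filter mem_index_enum andbT; exact: Qi.
  by move: Qi; rewrite mem_filter => /andP[].
elim: s => [|i s IH].
  rewrite big_nil (_ : [set t | _] = set0) ?Pr0//.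
  by apply/seteqP; split=> // t [].
rewrite big_cons; apply: le_trans (lerD (lexx _) IH).
apply: Pr_subset_setU => // t [j].
by rewrite inE => /orP[/eqP -> ?|js Fj]; [left|right; exists j].
Qed.

Lemma sum_Pr_disjoint_le A : measurable A -> (forall i, F i `<=` A) ->
  (forall i j t, F i t -> F j t -> i = j) -> \sum_i Pr P (F i) <= Pr P A.
Proof.
move=> mA FA Fdisj; have : uniq (index_enum I) by exact: index_enum_uniq.
set s := index_enum I => us.
apply: (@le_trans _ _ (Pr P [set t | exists2 i, i \in s & F i t])); last first.
  by apply: Pr_le => // t [i _]; exact: FA.
elim: s us => [_|i s IH /= /andP[iNs us]]; first by rewrite big_nil Pr_ge0.
rewrite big_cons; apply: le_trans (lerD (lexx _) (IH us)) _.
rewrite -Pr_setU//; last first.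
  apply/seteqP; split=> // t [Fi [j js Fj]].
  by move: iNs; rewrite (Fdisj i j t)// js.
apply: Pr_le => //; first exact: measurableU.
move=> t [Fi|[j js Fj]]; first by exists i; rewrite ?mem_head.
by exists j => //; rewrite inE js orbT.
Qed.

End finite_families.

Section events.
Variables U V : T -> R.
Hypotheses (mU : measurable_fun setT U) (mV : measurable_fun setT V).

Lemma measurable_gt (x : R) : measurable [set t | U t > x].
Proof.
rewrite (_ : [set t | _] = setT `&` U @^-1` `]x, +oo[%classic).
  exact: mU.
by apply/seteqP; split=> t /=; rewrite in_itv/= andbT// => -[].
Qed.

Lemma measurable_ge (x : R) : measurable [set t | x <= U t].
Proof.
rewrite (_ : [set t | _] = setT `&` U @^-1` `[x, +oo[%classic).
  exact: mU.
by apply/seteqP; split=> t /=; rewrite in_itv/= andbT// => -[].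
Qed.

Lemma measurable_lt (x : R) : measurable [set t | U t < x].
Proof.
rewrite (_ : [set t | _] = ~` [set t | x <= U t]).
  by apply: measurableC; exact: measurable_ge.
by apply/seteqP; split=> t /=; rewrite ltNge => /negP.
Qed.

Lemma measurable_le (x : R) : measurable [set t | U t <= x].
Proof.
rewrite (_ : [set t | _] = ~` [set t | U t > x]).
  by apply: measurableC; exact: measurable_gt.
by apply/seteqP; split=> t /=; rewrite leNgt => /negP.
Qed.

Lemma measurable_gt_norm (x : R) : measurable [set t | `|U t| > x].
Proof.
rewrite (_ : [set t | _] = [set t | U t > x] `|` [set t | U t < - x]).
  by apply: measurableU; [exact: measurable_gt|exact: measurable_lt].
apply/seteqP; split=> t /=; first by rewrite lter_normr => /orP[?|?]; [left|right; lra].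
by rewrite lter_normr => -[->//|?]; apply/orP; right; lra.
Qed.

Lemma measurable_gt_le (x y : R) : measurable [set t | x < U t <= y].
Proof.
rewrite (_ : [set t | _] = [set t | U t > x] `&` [set t | U t <= y]).
  by apply: measurableI; [exact: measurable_gt|exact: measurable_le].
by apply/seteqP; split=> t /= => [/andP//|[-> ->]].
Qed.

Lemma measurable_jgt (x y : R) : measurable [set t | U t > x /\ V t > y].
Proof.
rewrite (_ : [set t | _] = [set t | U t > x] `&` [set t | V t > y])//.
apply: measurableI; first exact: measurable_gt.
rewrite (_ : [set t | _] = setT `&` V @^-1` `]y, +oo[%classic).
  exact: mV.
by apply/seteqP; split=> t /=; rewrite in_itv/= andbT// => -[].
Qed.

Lemma jtail_ge0 x y : 0 <= jtail P U V x y.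
Proof. exact: Pr_ge0. Qed.

Lemma jtail_anti x y x' y' : x <= x' -> y <= y' ->
  jtail P U V x' y' <= jtail P U V x y.
Proof.
move=> xx yy; apply: Pr_le; [exact: measurable_jgt..|].
by move=> t /= [Ut Vt]; split; [exact: le_lt_trans Ut|exact: le_lt_trans Vt].
Qed.

End events.

Lemma tailE (Z : {RV P >-> R}) x : tail P Z x = Pr P [set t | Z t > x].
Proof.
rewrite /tail /Pr /ccdf /distribution /pushforward; congr (fine (P _)).
by apply/seteqP; split=> t /=; rewrite in_itv/= andbT.
Qed.

Lemma Pr_gt_cvg0 (U : T -> R) (e : R) : measurable_fun setT U -> 0 < e ->
  \forall x \near +oo, Pr P [set t | U t > x] < e.
Proof.
move=> mU e0; pose Z : {RV P >-> R} :=
  HB.pack_for {RV P >-> R} U (isMeasurableFun.Build _ _ _ _ _ mU).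
have /fine_cvgP[_] := cvg_ccdfy0 Z.
move=> /cvgrPdist_lt /(_ e e0); apply: filterS => x /=.
by rewrite sub0r normrN -[fine _]/(tail P Z x) tailE ger0_norm// Pr_ge0.
Qed.

Lemma Pr_small_positive (Z : {RV P >-> R}) (e : R) : 0 < e ->
  \forall h \near (0 : R)^'+, Pr P [set t | 0 < Z t <= h] < e.
Proof.
move=> e0; have := @ccdf_right_continuous _ _ _ P Z 0.
have mZ := measurable_funPT Z.
have ccdfE x : ccdf Z x = (Pr P [set t | Z t > x])%:E.
  by rewrite -tailE fineK// fin_num_measure.
rewrite ccdfE => /fine_cvgP[_] /cvgrPdist_lt /(_ e e0).
apply: filterS2 (nbhs_right_gt 0) => h h0 /=.
rewrite ccdfE/=; set p := Pr P [set t | h < Z t]; set q := Pr P [set t | 0 < Z t <= h].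
have m1 : measurable [set t | 0 < Z t <= h] by exact: measurable_gt_le.
have -> : Pr P [set t | 0 < Z t] = p + q.
  rewrite -Pr_setU//; last 2 first.
  - exact: measurable_gt.
  - apply/seteqP; split=> // t /= [ht /andP[_]]; rewrite leNgt ht//.
  congr (Pr P _); apply/seteqP; split=> t /=.
    by move=> Zt; have [|] := ltP h (Z t); [left|right; rewrite Zt].
  by case=> [/(lt_trans h0)|/andP[]].
by rewrite addrAC subrr add0r ger0_norm ?Pr_ge0.
Qed.

End finite_probability.

(** * The filter of simultaneously large arguments *)

Section large_arguments.
Variable R : realType.

Lemma near_oo2P (Q : R * R -> Prop) :
  (\forall z \near oo2 R, Q z) <->
  (exists2 M, 0 <= M & forall x y, M < x -> M < y -> Q (x, y)).
Proof.
split=> [[[A B] /= [[a [_ Aa]] [b [_ Bb]]] AB]|[M M0 MQ]].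
  exists (Num.max 0 (Num.max a b)); first by rewrite le_max lexx.
  move=> x y; rewrite !gt_max => /andP[_ /andP[ax _]] /andP[_ /andP[_ yb]].
  by apply: AB; split=> /=; [exact: Aa|exact: Bb].
exists (`]M, +oo[%classic, `]M, +oo[%classic) => /=.
  by split; exists M; split; rewrite ?num_real// => x Mx /=; rewrite in_itv/= Mx.
by move=> [x y] [] /=; rewrite !in_itv/= !andbT; exact: MQ.
Qed.

Lemma near_oo2_comp (f g : R -> R) (Q : R * R -> Prop) :
  f x @[x --> +oo] --> +oo -> g x @[x --> +oo] --> +oo ->
  (\forall z \near oo2 R, Q z) -> \forall z \near oo2 R, Q (f z.1, g z.2).
Proof.
move=> fy gy [[A B] /= [Ay By] AB].
exists (f @^-1` A, g @^-1` B) => /=; first by split; [exact: fy|exact: gy].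
by move=> [x y] [/= Ax By']; apply: AB.
Qed.

Lemma near_oo3_comp (f g h : R -> R) (Q : R * R * R -> Prop) :
  f x @[x --> +oo] --> +oo -> g x @[x --> +oo] --> +oo ->
  h x @[x --> +oo] --> +oo -> (\forall z \near oo3 R, Q z) ->
  \forall L \near +oo, \forall z \near oo2 R, Q (f L, g z.1, h z.2).
Proof.
move=> fy gy hy [[A B] /= [[[A1 A2] /= [A1y A2y] A12] By] AB].
have fA : \forall L \near +oo, A1 (f L) by exact: fy.
apply: filterS fA => L AL.
exists (g @^-1` A2, h @^-1` B) => /=; first by split; [exact: gy|exact: hy].
by move=> [x y] [/= Ax By']; apply: AB; split => //=; exact: A12.
Qed.

Lemma scale_cvgy (b : R) : 0 < b -> b * x @[x --> +oo] --> +oo.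
Proof.
move=> b0; apply/cvgryPge => A; near=> x.
by rewrite -ler_pdivrMl//; near: x; exact: nbhs_pinfty_ge (num_real _).
Unshelve. all: by end_near. Qed.

Lemma shift_cvgy (L : R) : x - L @[x --> +oo] --> +oo.
Proof.
apply/cvgryPge => A; near=> x.
by rewrite lerBrDr; near: x; exact: nbhs_pinfty_ge (num_real _).
Unshelve. all: by end_near. Qed.

Lemma near_oo2_gt (M : R) : \forall z \near oo2 R, M < z.1 /\ M < z.2.
Proof.
apply/near_oo2P; exists (Num.max 0 M); first by rewrite le_max lexx.
by move=> x y /=; rewrite !gt_max => /andP[_ ->] /andP[_ ->].
Qed.

End large_arguments.

Section ratio_estimates.
Context (R : realType) (S : Type) (F : set_system S).
Context {FF : Filter F}.
Implicit Types f g : S -> R.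

Lemma ratio_cvg_le f g l l' : ratio_cvg F f g l -> l < l' ->
  \forall z \near F, f z <= l' * g z.
Proof.
move=> [g0 fg] ll'; have l0 : 0 < l' - l by rewrite subr_gt0.
have /cvgrPdist_lt/(_ _ l0) fgl := fg; near=> z.
rewrite -ler_pdivrMr; last by near: z.
have : `|l - f z / g z| < l' - l by near: z.
by rewrite ltr_norml => /andP[? ?]; lra.
Unshelve. all: by end_near. Qed.

(** Equivalences are proved and combined in this two-sided form, which passes
    to finite sums without any division. *)
Lemma asymp_equiv_squeeze f g : (\forall z \near F, 0 < g z) ->
  (forall e, 0 < e -> \forall z \near F,
     (1 - e) * g z <= f z <= (1 + e) * g z) ->
  asymp_equiv F f g.
Proof.
move=> g0 fg; split=> //; apply/cvgrPdist_le => e e0; near=> z.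
have gz : 0 < g z by near: z.
have /andP[h1 h2] : (1 - e) * g z <= f z <= (1 + e) * g z by near: z; exact: fg.
rewrite distrC ler_distl ler_pdivlMr// ler_pdivrMr//.
by rewrite h1 h2.
Unshelve. all: by end_near. Qed.

Lemma asymp_equiv_squeezed f g e : asymp_equiv F f g -> 0 < e ->
  \forall z \near F, (1 - e) * g z <= f z <= (1 + e) * g z.
Proof.
move=> [g0 fg] e0; have /cvgrPdist_le/(_ e e0) fge := fg; near=> z.
have gz : 0 < g z by near: z.
have : `|1 - f z / g z| <= e by near: z.
by rewrite distrC ler_distl ler_pdivlMr// ler_pdivrMr.
Unshelve. all: by end_near. Qed.

Lemma asymp_equiv_trans f g h :
  asymp_equiv F f g -> asymp_equiv F g h -> asymp_equiv F f h.
Proof.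
move=> [g0 fg] [h0 gh]; split=> //.
have fgh : f z / g z * (g z / h z) @[z --> F] --> (1 : R).
  by rewrite -[X in _ --> X]mulr1; exact: cvgM.
apply: cvg_trans fgh; apply: near_eq_cvg.
near=> z; have gz : 0 < g z by near: z.
by rewrite mulrA divfK// gt_eqF.
Unshelve. all: by end_near. Qed.

Lemma asymp_equiv_sum (I : finType) (f g : I -> S -> R) (i0 : I) :
  (forall i, asymp_equiv F (f i) (g i)) ->
  asymp_equiv F (fun z => \sum_i f i z) (fun z => \sum_i g i z).
Proof.
move=> fg; apply: asymp_equiv_squeeze => [|e e0].
  have : \forall z \near F, forall i, 0 < g i z.
    by apply: (filter_forall (f := fun i z => 0 < g i z)) => i; have [] := fg i.
  apply: filterS => z gz; rewrite (bigD1 i0)//=.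
  by rewrite ltr_pwDl// sumr_ge0// => i _; exact: ltW.
have : \forall z \near F, forall i, (1 - e) * g i z <= f i z <= (1 + e) * g i z.
  by apply: filter_forall => i; exact: asymp_equiv_squeezed.
apply: filterS => z fgz; rewrite !mulr_sumr.
by apply/andP; split; apply: ler_sum => i _; have /andP[] := fgz i.
Qed.

End ratio_estimates.

(** * Regularity of joint tails *)

Section regularity.
Variable R : realType.
Implicit Types H : R -> R -> R.

Definition antitone2 H := forall x y x' y', x <= x' -> y <= y' ->
  H x' y' <= H x y.

(** The trace of dominated variation; as the tails below are antitone, one
    common factor for the two coordinates is as good as two. The same remark
    applies to the other two predicates, which come from consistent variation
    and from long tails. *)
Definition scale_bounded H := forall b : R, 0 < b < 1 ->
  exists2 C : R, 0 < C &
    \forall z \near oo2 R, H (b * z.1) (b * z.2) <= C * H z.1 z.2.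

Definition scale_insensitive H := forall e : R, 0 < e ->
  exists2 c : R, 0 < c < 1 &
    \forall z \near oo2 R, H (c * z.1) (c * z.2) <= (1 + e) * H z.1 z.2.

Definition shift_insensitive H := forall e L : R, 0 < e -> 0 <= L ->
  \forall z \near oo2 R, H (z.1 - L) (z.2 - L) <= (1 + e) * H z.1 z.2.

(** Iterating the insensitivity to the factor [c] reaches every factor, since
    the powers of [c] tend to 0. *)
Lemma scale_insensitive_bounded H : antitone2 H -> scale_insensitive H ->
  scale_bounded H.
Proof.
move=> aH iH b /andP[b0 b1].
have [c /andP[c0 c1] Hc] := iH 1 ltr01.
have Hk k : \forall z \near oo2 R,
    H (c ^+ k * z.1) (c ^+ k * z.2) <= (1 + 1) ^+ k * H z.1 z.2.
  elim: k => [|k IH]; first by apply: nearW => z; rewrite !expr0 !mul1r.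
  have Hck := near_oo2_comp (scale_cvgy (exprn_gt0 k c0))
    (scale_cvgy (exprn_gt0 k c0)) Hc.
  near=> z; rewrite !exprS -!mulrA.
  apply: (@le_trans _ _ ((1 + 1) * H (c ^+ k * z.1) (c ^+ k * z.2))).
    by near: z.
  by rewrite ler_pM2l//; near: z.
have [k ckb] : exists k, c ^+ k <= b.
  have /cvgrPdist_le /(_ b b0) [k _ /(_ k (leqnn _))] :
      c ^+ k @[k --> \oo] --> 0.
    by apply: cvg_expr; rewrite ger0_norm ?ltW.
  rewrite /= sub0r normrN ger0_norm; last exact/exprn_ge0/ltW.
  by move=> ckb; exists k.
exists ((1 + 1) ^+ k); first by rewrite exprn_gt0.
near=> z; have [z1 z2] : 0 < z.1 /\ 0 < z.2 by near: z; exact: near_oo2_gt.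
apply: (@le_trans _ _ (H (c ^+ k * z.1) (c ^+ k * z.2))).
  by apply: aH; rewrite ler_pM2r.
by near: z; exact: Hk.
Unshelve. all: by end_near. Qed.

(** A constant shift is eventually smaller than any given proportion of the
    threshold. *)
Lemma scale_insensitive_shift H : antitone2 H -> scale_insensitive H ->
  shift_insensitive H.
Proof.
move=> aH iH e L e0 L0; have [c /andP[c0 c1] Hc] := iH e e0.
near=> z; have [z1 z2] : L / (1 - c) < z.1 /\ L / (1 - c) < z.2.
  by near: z; exact: near_oo2_gt.
apply: (@le_trans _ _ (H (c * z.1) (c * z.2))); last by near: z.
by move: z1 z2; rewrite !ltr_pdivrMr ?subr_gt0// => z1 z2; apply: aH; lra.
Unshelve. all: by end_near. Qed.

End regularity.

Section regular_classes.
Context d (T : measurableType d) (R : realType) (P : probability T R).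
Variables X Y : {RV P >-> R}.

Lemma jtail_antitone (U V : T -> R) :
  measurable_fun setT U -> measurable_fun setT V -> antitone2 (jtail P U V).
Proof. by move=> mU mV x y x' y'; exact: jtail_anti. Qed.

Lemma limsup_ratio2_lt (b : R * R) (C : R) : jtail_pos X Y ->
  (limsup_ratio2 X Y b < C%:E)%E ->
  \forall z \near oo2 R,
    jtail P X Y (b.1 * z.1) (b.2 * z.2) <= C * jtail P X Y z.1 z.2.
Proof.
move=> pos; rewrite /limsup_ratio2 /limf_esup => /ereal_inf_lt[_ [A Ay <-]] AC.
near=> z; rewrite -ler_pdivrMr; last by near: z.
rewrite -lee_fin; apply/ltW/(le_lt_trans _ AC)/ereal_sup_ubound => /=.
by exists z => //; near: z.
Unshelve. all: by end_near. Qed.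

Lemma class_D2_scale_bounded : class_D2 P X Y -> scale_bounded (jtail P X Y).
Proof.
move=> [_ _ pos D] b b01; have /= := D (b, b) b01 b01.
case: (limsup_ratio2 X Y (b, b)) (@limsup_ratio2_lt (b, b)) => [r||] //= lim _.
  exists (Num.max 1 (r + 1)); first by rewrite lt_max ltr01.
  by apply: lim => //; rewrite lte_fin lt_max ltrDl ltr01 orbT.
by exists 1 => //; apply: lim => //; rewrite ltNyr.
Qed.

Lemma class_C2_scale_insensitive : class_C2 P X Y ->
  scale_insensitive (jtail P X Y).
Proof.
move=> [_ _ pos C] e e0.
have /C[[A B] /= [A1 B1] AB] : nbhs (1 : \bar R)%E [set u | (u < (1 + e)%:E)%E].
  apply: open_nbhs_nbhs; split; first exact: open_ereal_lt_ereal.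
  by rewrite /= lte_fin ltrDl.
have [c [[Ac Bc] c01]] : exists c : R, (A c /\ B c) /\ 0 < c < 1.
  near (1 : R)^'- => c; exists c; split; first split.
  - by near: c.
  - by near: c.
  - by apply/andP; split; near: c; [apply: nbhs_left_gt|apply: nbhs_left_lt].
exists c => //; apply: (@limsup_ratio2_lt (c, c)) => //.
exact: AB.
Unshelve. all: by end_near. Qed.

Lemma class_L2_shift_insensitive : class_L2 P X Y ->
  shift_insensitive (jtail P X Y).
Proof.
move=> [_ _ L2] e L e0; rewrite le_eqVlt => /predU1P[<-|L0].
  apply: nearW => z; rewrite !subr0 mulrDl mul1r lerDl.
  by rewrite mulr_ge0 ?jtail_ge0 ?ltW.
apply: ratio_cvg_le; first apply: L2; rewrite ?(ltW L0)//.
  by apply/eqP => -[] /eqP; rewrite gt_eqF.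
by rewrite ltrDl.
Qed.

Lemma class_R2_scale_insensitive (a1 a2 : R) : 0 < a1 -> 0 < a2 ->
  class_R2 P a1 a2 X Y -> scale_insensitive (jtail P X Y).
Proof.
move=> a10 a20 [_ _ R2] e e0.
have a0 : 0 < a1 + a2 by rewrite addr_gt0.
(* The exact limit of the ratio at [(c, c)] is [1 + e / 2]. *)
pose c := (1 + e / 2) `^ (- (a1 + a2)^-1).
have e2 : 1 < 1 + e / 2 by rewrite ltrDl divr_gt0.
have c0 : 0 < c by rewrite powR_gt0// (lt_trans ltr01).
exists c.
  rewrite c0/= /c powRN invf_lt1 ?powR_gt0 ?(lt_trans ltr01)//.
  have := @gt0_ltr_powR R (a1 + a2)^-1 _ 1 (1 + e / 2) _ _ e2.
  by rewrite powR1 !nnegrE invr_gt0; apply => //; rewrite ltW// (lt_trans ltr01).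
apply: ratio_cvg_le; first exact: R2.
rewrite -powRD; last by apply/implyP => _; rewrite gt_eqF.
rewrite /c -powRrM -opprD mulrNN mulVf ?gt_eqF// powRr1; lra.
Qed.

Lemma class_R2_jtail_pos (a1 a2 : R) : class_R2 P a1 a2 X Y -> jtail_pos X Y.
Proof. by move=> [_ _ /(_ 1 1 ltr01 ltr01)[]]. Qed.

End regular_classes.

(** * Conditioning on an independent weight *)

Section pairing.
Context d (T : measurableType d) d1 d2 (E1 : measurableType d1)
  (E2 : measurableType d2).

Definition pair_map (V : T -> E1) (W : T -> E2) t := (V t, W t).

Lemma measurable_pair_map (V : {mfun T >-> E1}) (W : {mfun T >-> E2}) :
  measurable_fun setT (pair_map V W).
Proof. exact: measurable_fun_pair. Qed.

HB.instance Definition _ (V : {mfun T >-> E1}) (W : {mfun T >-> E2}) :=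
  isMeasurableFun.Build _ _ _ _ (pair_map V W) (measurable_pair_map V W).

End pairing.

Section mixture.
Context d (T : measurableType d) (R : realType) (P : probability T R).
Context d1 d2 (E1 : measurableType d1) (E2 : measurableType d2).
Variables (V : {mfun T >-> E1}) (W : {mfun T >-> E2}).

Definition independent_maps := forall A B, measurable A -> measurable B ->
  P (V @^-1` A `&` W @^-1` B) = (P (V @^-1` A) * P (W @^-1` B))%E.

Hypothesis VW : independent_maps.

Lemma measurable_pair_event (S : set (E1 * E2)) : measurable S ->
  measurable [set t | S (V t, W t)].
Proof. by move=> mS; rewrite -[X in measurable X]setTI; exact: measurable_pair_map. Qed.

Lemma measurable_section_event (S : set (E1 * E2)) v : measurable S ->
  measurable [set s | S (v, W s)].
Proof.
move=> mS; rewrite -[X in measurable X]setTI.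
exact: (measurable_fun_pair (measurable_cst v) (measurable_funPT W)).
Qed.

Lemma measurable_section_prob (S : set (E1 * E2)) : measurable S ->
  measurable_fun setT (fun t => P [set s | S (V t, W s)]).
Proof.
move=> mS.
have := measurable_fun_xsection (distribution P W) mS.
move=> /(measurableT_comp) /(_ (measurable_funPT V)).
apply: eq_measurable_fun => t _ /=.
by rewrite /distribution /pushforward; congr (P _); apply/seteqP; split=> s /=;
  rewrite /xsection/= inE.
Qed.

(** The law of [(V, W)] is a product measure, by uniqueness of the latter. *)
Lemma mixture (S : set (E1 * E2)) : measurable S ->
  P [set t | S (V t, W t)] = (\int[P]_t P [set s | S (V t, W s)])%E.
Proof.
move=> mS; have := @product_measure_unique _ _ _ _ _ (distribution P V)
  (distribution P W) (distribution P (pair_map V W)).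
have H A B : measurable A -> measurable B ->
    distribution P (pair_map V W) (A `*` B) = (distribution P V A * distribution P W B)%E.
  by move=> mA mB; rewrite -VW.
move=> /(_ H S mS) E.
transitivity ((distribution P V \x distribution P W)%E S); first exact: esym E.
rewrite /product_measure1.
rewrite ge0_integral_distribution//=; last exact: (measurable_fun_xsection (distribution P W)).
apply: eq_integral => t _ /=.
by rewrite /distribution /pushforward; congr (P _); apply/seteqP; split=> s /=;
  rewrite /xsection/= inE.
Qed.

(** Given the weights, a product exceeds a threshold when the claim exceeds a
    rescaled one. This is how inequalities between the tails of the claims, if
    they hold uniformly in the thresholds, reach the tails of the products. *)
Lemma mixture_le (S1 S2 : set (E1 * E2)) (K : R) :
  measurable S1 -> measurable S2 -> 0 <= K ->
  (forall v, Pr P [set s | S1 (v, W s)] <= K * Pr P [set s | S2 (v, W s)]) ->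
  Pr P [set t | S1 (V t, W t)] <= K * Pr P [set t | S2 (V t, W t)].
Proof.
move=> mS1 mS2 K0 S12; rewrite -lee_fin EFinM -!PrE; [|exact: measurable_pair_event..].
rewrite !mixture// -ge0_integralZl//; [|exact: measurable_section_prob].
apply: ge0_le_integral => //.
- exact: measurable_section_prob.
- by apply: measurable_funeM; exact: measurable_section_prob.
- move=> t _; rewrite !PrE; [|exact: measurable_section_event..].
  by rewrite -EFinM lee_fin.
Qed.

Lemma Pr_independent A B : measurable A -> measurable B ->
  Pr P (V @^-1` A `&` W @^-1` B) = Pr P (V @^-1` A) * Pr P (W @^-1` B).
Proof.
move=> mA mB; rewrite /Pr VW// fineM//; apply: fin_num_measure.
  exact: measurable_funPTI.
exact: measurable_funPTI.
Qed.

End mixture.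

(** * One big jump in each coordinate *)

Section ruin_events.
Context d (T : measurableType d) (R : realType) (P : probability T R) (n : nat).

Definition ruined (u : 'I_n -> R) (x : R) : Prop :=
  exists k : 'I_n, x < \sum_(i < n | (i <= k)%N) u i.

Lemma ruin_time_le (Theta X : 'I_n -> {RV P >-> R}) (x : R) t :
  (ruin_time Theta X x t <= n%:R%:E)%E <-> ruined (fun i => Theta i t * X i t) x.
Proof.
split=> [le_n|[k xk]].
- apply: contrapT => no_ruin; move: le_n; rewrite /ruin_time.
  rewrite (_ : image _ _ = set0) ?ereal_inf0 ?leye_eq//.
  apply/seteqP; split=> // r [[|k] [//= kn xk] _].
  by apply: no_ruin; exists (Ordinal kn); move: xk; rewrite /surplus subr_lt0.
- apply: (@le_trans _ _ (k.+1%:R%:E)); last by rewrite lee_fin ler_nat.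
  apply: ereal_inf_lbound; exists k.+1 => //; split; first by rewrite /= ltn_ord.
  by rewrite /surplus subr_lt0.
Qed.

Lemma psi_andE (Theta Delta X Y : 'I_n -> {RV P >-> R}) (x y : R) :
  psi_and P Theta Delta X Y x y =
  Pr P [set t | ruined (fun i => (Theta i \* X i) t) x /\
                ruined (fun j => (Delta j \* Y j) t) y].
Proof.
rewrite /psi_and; congr (Pr P _); apply/seteqP; split=> t /=.
  by rewrite ge_max => /andP[/ruin_time_le ? /ruin_time_le].
by rewrite ge_max => -[/ruin_time_le -> /ruin_time_le].
Qed.

Lemma sum_off_diagonal (c : R) (i : 'I_n) : \sum_(j < n | j != i) c = n%:R * c - c.
Proof.
apply/(addrI c); rewrite -(bigD1 (P := predT) (F := fun=> c) i)//=.
by rewrite sumr_const card_ord -mulr_natl; lra.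
Qed.

(** If all terms were at most [x / n], no partial sum could exceed [x]. The same
    would hold if one term were at most [x - l] and the others at most
    [l / n]. *)
Lemma ruined_big_jump (u : 'I_n -> R) (x l : R) : 0 < l <= x -> ruined u x ->
  exists i, x / n%:R < u i /\
    (x - l < u i \/ exists2 k, k != i & l / n%:R < `|u k|).
Proof.
move=> /andP[l0 lx] [k xk].
have n0 : 0 < n%:R :> R by rewrite ltr0n (leq_ltn_trans _ (ltn_ord k)).
have sum_le w : (forall j, 0 <= w j) -> (forall j, u j <= w j) ->
    \sum_(i < n | (i <= k)%N) u i <= \sum_i w i.
  move=> w0 uw; rewrite [leRHS](bigID (fun i : 'I_n => (i <= k)%N))/= -[leLHS]addr0.
  by apply: lerD; [exact: ler_sum|exact: sumr_ge0].
have [i xi] : exists i, x / n%:R < u i.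
  apply: contrapT => /forallNP small; suff : x < x by rewrite ltxx.
  apply: (lt_le_trans xk); apply: (le_trans (sum_le (fun=> x / n%:R) _ _)).
  - by move=> _; rewrite divr_ge0 ?ltW// (lt_le_trans l0).
  - by move=> j; rewrite leNgt; exact/negP/small.
  - by rewrite sumr_const card_ord -[leLHS]mulr_natr divfK ?gt_eqF.
exists i; split=> //; apply: contrapT => /not_orP[/negP + small].
rewrite -leNgt => uix; suff : x < x by rewrite ltxx.
apply: (lt_le_trans xk).
apply: (le_trans (sum_le (fun j => if j == i then x - l else l / n%:R) _ _)).
- by move=> j; case: ifP => _; rewrite ?subr_ge0// divr_ge0 ?ltW.
- move=> j; case: ifPn => [/eqP -> //|ji]; apply: le_trans (ler_norm _) _.
  by rewrite leNgt; apply/negP => lj; apply: small; exists j.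
- rewrite (bigD1 i)//= eqxx (eq_bigr (fun=> l / n%:R)).
    rewrite sum_off_diagonal mulrC divfK ?gt_eqF//.
    by have : 0 < l / n%:R by [exact: divr_gt0]; lra.
  by move=> j /negbTE ->.
Qed.

Lemma big_jump_ruined (u : 'I_n -> R) (x l : R) (i : 'I_n) : 0 < l ->
  x + l < u i -> (forall k, k != i -> `|u k| <= l / n%:R) -> ruined u x.
Proof.
move=> l0 xi small.
have n0 : (0 < n)%N by rewrite (leq_ltn_trans _ (ltn_ord i)).
have n1 : (n.-1 < n)%N by rewrite prednK.
exists (Ordinal n1); rewrite (eq_bigl predT) => [|j]; last first.
  by rewrite /= -ltnS prednK// ltn_ord.
rewrite (bigD1 i)//=.
have : \sum_(j < n | j != i) - (l / n%:R) <= \sum_(j < n | j != i) u j.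
  by apply: ler_sum => j /small; rewrite ler_norml => /andP[].
rewrite sum_off_diagonal mulrN mulrC divfK ?pnatr_eq0 -?lt0n//.
by have : 0 < l / n%:R by [rewrite divr_gt0// ltr0n]; lra.
Qed.

Lemma big_jump_dominates (i : 'I_n) (z g w : R) : 0 < g <= z -> z + g < w ->
  z / n%:R < w /\ g / n%:R < `|w|.
Proof.
move=> /andP[g0 gz] zw.
have n0 : 0 < n%:R :> R by rewrite ltr0n (leq_ltn_trans _ (ltn_ord i)).
have n1 : 1 <= n%:R :> R by rewrite ler1n -(ltr0n R).
have w0 : 0 < w by lra.
have wn : w <= w * n%:R by rewrite ler_peMr// ltW.
by rewrite (gtr0_norm w0) !ltr_pdivrMr//; split; lra.
Qed.

Section two_lines.
Variables U V : 'I_n -> T -> R.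
Hypotheses (mU : forall i, measurable_fun setT (U i))
           (mV : forall j, measurable_fun setT (V j)).

(** What may prevent the ruin of the two lines from being due to one big jump
    in each; the asymptotics rest on the negligibility of these events. *)
Definition extra_jump (U V : 'I_n -> T -> R) (l x y : R) (i k j : 'I_n) :=
  [set t | [/\ `|U k t| > l, U i t > x & V j t > y]].

Lemma measurable_extra_jump (U' V' : 'I_n -> T -> R) l x y i k j :
  (forall i, measurable_fun setT (U' i)) ->
  (forall i, measurable_fun setT (V' i)) ->
  measurable (extra_jump U' V' l x y i k j).
Proof.
move=> mU' mV'.
rewrite (_ : extra_jump _ _ _ _ _ _ _ _ =
  [set t | `|U' k t| > l] `&` [set t | U' i t > x /\ V' j t > y]).
  by apply: measurableI; [exact: measurable_gt_norm|exact: measurable_jgt].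
by apply/seteqP; split=> t /= [?] => [|[]].
Qed.

Definition ruin_event (x y : R) :=
  [set t | ruined (fun i => U i t) x /\ ruined (fun j => V j t) y].

Lemma measurable_ruin_event x y : measurable (ruin_event x y).
Proof.
have mS (W : 'I_n -> T -> R) z : (forall i, measurable_fun setT (W i)) ->
    measurable [set t | ruined (fun i => W i t) z].
  move=> mW; rewrite (_ : [set t | _] = [set t | exists2 k : 'I_n, predT k &
      [set t | \sum_(i < n | (i <= k)%N) W i t > z] t]).
    apply: measurable_exists => k; apply: measurable_gt.
    under eq_fun do rewrite -big_filter.
    exact: measurable_sum.
  by apply/seteqP; split=> t [k]; [exists k|move=> _; exists k].
by apply: measurableI; exact: mS.
Qed.

Let tri : finType := ('I_n * 'I_n * 'I_n)%type.

Let bad_event (l m x y : R) : set T :=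
  [set t | exists2 p : tri, p.1.2 != p.1.1 &
     extra_jump U V (l / n%:R) (x / n%:R) (y / n%:R) p.1.1 p.1.2 p.2 t] `|`
  [set t | exists2 p : tri, p.1.2 != p.1.1 &
     extra_jump V U (m / n%:R) (y / n%:R) (x / n%:R) p.1.1 p.1.2 p.2 t].

Let measurable_bad l m x y : measurable (bad_event l m x y).
Proof.
by apply: measurableU; apply: measurable_exists => p; exact: measurable_extra_jump.
Qed.

Let Pr_bad (l m x y e : R) : 0 <= e ->
  (forall i k j, k != i ->
    Pr P (extra_jump U V (l / n%:R) (x / n%:R) (y / n%:R) i k j) <= e) ->
  (forall i k j, k != i ->
    Pr P (extra_jump V U (m / n%:R) (y / n%:R) (x / n%:R) i k j) <= e) ->
  Pr P (bad_event l m x y) <= (#|tri| * 2)%:R * e.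
Proof.
move=> e0 bU bV.
have H (F : tri -> set T) : (forall p, measurable (F p)) ->
    (forall p, p.1.2 != p.1.1 -> Pr P (F p) <= e) ->
    Pr P [set t | exists2 p : tri, p.1.2 != p.1.1 & F p t] <= #|tri|%:R * e.
  move=> mF Fe; apply: le_trans (Pr_exists_le P mF (fun p => p.1.2 != p.1.1)) _.
  apply: le_trans (ler_sum _ Fe) _.
  rewrite mulr_natl -[leRHS]sumr_const [leRHS](bigID (fun p : tri => p.1.2 != p.1.1)).
  by rewrite lerDl sumr_ge0.
rewrite natrM mulrAC mulr_natr mulr2n.
apply: le_trans (Pr_setU_le P _ _) (lerD _ _).
- by apply: measurable_exists => p; exact: measurable_extra_jump.
- by apply: measurable_exists => p; exact: measurable_extra_jump.
- by apply: H => p; [exact: measurable_extra_jump|exact: bU].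
- by apply: H => p; [exact: measurable_extra_jump|exact: bV].
Qed.

Let pair_jump (x y : R) (p : 'I_n * 'I_n) : set T :=
  [set t | U p.1 t > x /\ V p.2 t > y].

Let measurable_pair_jump x y p : measurable (pair_jump x y p).
Proof. exact: measurable_jgt. Qed.

(** Outside the events [extra_jump], joint ruin means that there is exactly one
    pair of big jumps, up to the gaps [l] and [m] in their sizes. *)
Lemma ruin_event_bounds (l m x y e : R) : 0 < l <= x -> 0 < m <= y -> 0 <= e ->
  (forall i k j, k != i ->
    Pr P (extra_jump U V (l / n%:R) (x / n%:R) (y / n%:R) i k j) <= e) ->
  (forall i k j, k != i ->
    Pr P (extra_jump V U (m / n%:R) (y / n%:R) (x / n%:R) i k j) <= e) ->
  let b := (#|{: 'I_n * 'I_n * 'I_n}| * 2)%:R * e in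
  Pr P (ruin_event x y) <=
    \sum_(i < n) \sum_(j < n) jtail P (U i) (V j) (x - l) (y - m) + b /\
  \sum_(i < n) \sum_(j < n) jtail P (U i) (V j) (x + l) (y + m) <=
    Pr P (ruin_event x y) + #|{: 'I_n * 'I_n}|%:R * b.
Proof.
move=> lx my e0 bU bV b; have be := Pr_bad e0 bU bV.
rewrite !pair_big/=; split.
- apply: le_trans (lerD (Pr_exists_le P (measurable_pair_jump _ _) predT) be).
  apply: Pr_subset_setU => //.
  + exact: measurable_ruin_event.
  + exact: measurable_exists.
  move=> t [/(ruined_big_jump lx)[i [xi hi]] /(ruined_big_jump my)[j [yj hj]]].
  case: hi => [xli|[k ki lk]]; last first.
    by right; left; exists (i, k, j).
  case: hj => [ymj|[k kj mk]]; last first.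
    by right; right; exists (j, k, i).
  by left; exists (i, j).
(* Off the bad event the pairs of big jumps exclude each other. *)
- pose F p := pair_jump (x + l) (y + m) p `\` bad_event l m x y.
  have mF p : measurable (F p) by exact: measurableD.
  have FP i j t : F (i, j) t -> [/\ x + l < U i t, y + m < V j t,
      forall k, k != i -> `|U k t| <= l / n%:R &
      forall k, k != j -> `|V k t| <= m / n%:R].
    move=> [[/= Ui Vj] nb]; have [Ui' _] := big_jump_dominates i lx Ui.
    have [Vj' _] := big_jump_dominates j my Vj.
    split=> // k ki; rewrite leNgt; apply/negP => lk; apply: nb.
      by left; exists (i, k, j).
    by right; exists (j, k, i).
  have Fdisj p q t : F p t -> F q t -> p = q.
    case: p => i j; case: q => i' j' /FP[_ _ Us Vs] /FP[Ui' Vj' _ _].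
    have [_ Ul] := big_jump_dominates i lx Ui'.
    have [_ Vm] := big_jump_dominates j my Vj'.
    congr (_, _); apply/eqP; rewrite eq_sym; apply: contraT.
      by move/Us; rewrite leNgt Ul.
    by move/Vs; rewrite leNgt Vm.
  have Fruin p : F p `<=` ruin_event x y.
    case: p => i j t /FP[Ui Vj Us Vs].
    have /andP[l0 _] := lx; have /andP[m0 _] := my.
    split; first exact: (@big_jump_ruined (U ^~ t) x l i).
    exact: (@big_jump_ruined (V ^~ t) y m j).
  have := sum_Pr_disjoint_le P mF (measurable_ruin_event x y) Fruin Fdisj.
  rewrite -(lerD2r (#|{: 'I_n * 'I_n}|%:R * b)); apply: le_trans.
  rewrite mulr_natl -sumr_const -big_split/=.
  apply: ler_sum => p _; apply: le_trans (lerD (lexx _) be).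
  apply: Pr_subset_setU => //; first exact: measurable_jgt.
  by move=> t pt; case: (pselect (bad_event l m x y t)); [right|left].
Qed.

End two_lines.
End ruin_events.

(** * Tails of products with bounded independent weights *)

Lemma mulr_gt_pos (R : realDomainType) (z w u : R) :
  u < z * w -> 0 <= z -> 0 <= u -> 0 < z.
Proof.
move=> uzw z0 u0; rewrite lt_neqAle z0 andbT.
by apply: contraTneq uzw => <-; rewrite mul0r -leNgt.
Qed.

Lemma lt_of_lt_weighted (R : realFieldType) (B z w u : R) : 0 < B ->
  0 <= z -> z <= B -> 0 <= u -> u < z * w -> B^-1 * u < w.
Proof.
move=> B0 z0 zB u0 uzw; rewrite ltr_pdivrMl// (lt_le_trans uzw)//.
have zpos := mulr_gt_pos uzw z0 u0.
rewrite ler_wpM2r// leNgt; apply/negP => w0.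
by move: uzw; rewrite ltNge (le_trans _ u0)// pmulr_rle0// ltW.
Qed.

Section weighted_pair.
Context d (T : measurableType d) (R : realType) (P : probability T R).
Variables theta delta X Y : {RV P >-> R}.
Hypotheses (theta_ge0 : forall t, 0 <= theta t)
           (delta_ge0 : forall t, 0 <= delta t).
Hypothesis indep : independent_maps P (pair_map theta delta) (pair_map X Y).
Variable B : R.
Hypotheses (B_gt1 : 1 < B)
           (theta_le : Pr P [set t | theta t > B] = 0)
           (delta_le : Pr P [set t | delta t > B] = 0).

Local Notation H := (jtail P X Y).
Local Notation A := (jtail P (theta \* X) (delta \* Y)).

Let B_gt0 : 0 < B. Proof. by rewrite (lt_trans ltr01). Qed.

Let mprod (U V : {RV P >-> R}) : measurable_fun setT (U \* V).
Proof. exact: measurable_funM. Qed.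

Let H_antitone : antitone2 H.
Proof. exact: jtail_antitone. Qed.

Lemma Pr_le_off_null (E F : set T) : measurable E -> measurable F ->
  (forall t, theta t <= B -> delta t <= B -> E t -> F t) -> Pr P E <= Pr P F.
Proof.
move=> mE mF EF.
have mth : measurable [set t | theta t > B] by exact: measurable_gt.
have mde : measurable [set t | delta t > B] by exact: measurable_gt.
rewrite -[leRHS]addr0 -{1}theta_le -[leRHS]addr0 -{1}delta_le -addrA.
apply: le_trans (lerD (lexx _) (Pr_setU_le P mth mde)).
apply: Pr_subset_setU => //; first exact: measurableU.
move=> t Et; have [tB|tB] := leP (theta t) B; last by right; left.
have [dB|dB] := leP (delta t) B; last by right; right.
by left; exact: EF.
Qed.

(** The upper bound keeps the rescaled thresholds [x / v] large; a positive
    lower bound keeps the rescaled shifts [L / v] bounded. *)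
Definition weight_box (a : R) : set (R * R) :=
  [set v | (a < v.1 <= B) /\ (a < v.2 <= B)].

Lemma measurable_weight_box a : measurable (weight_box a).
Proof.
rewrite (_ : weight_box a = `]a, B]%classic `*` `]a, B]%classic).
  exact: measurableX.
by apply/seteqP; split=> -[v w] /=; rewrite !in_itv.
Qed.

Definition scaled_tail (x y : R) : set ((R * R) * (R * R)) :=
  [set p | p.1.1 * p.2.1 > x /\ p.1.2 * p.2.2 > y].

Lemma measurable_scaled_tail x y : measurable (scaled_tail x y).
Proof.
apply: measurable_jgt; apply: measurable_funM.
- by apply: measurableT_comp => //; exact: measurable_fst.
- by apply: measurableT_comp => //; exact: measurable_snd.
- by apply: measurableT_comp => //; exact: measurable_fst.
- by apply: measurableT_comp => //; exact: measurable_snd.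
Qed.

Let boxed_tail a x y : set ((R * R) * (R * R)) :=
  fst @^-1` weight_box a `&` scaled_tail x y.

Let measurable_boxed_tail a x y : measurable (boxed_tail a x y).
Proof.
apply: measurableI; last exact: measurable_scaled_tail.
rewrite -[X in measurable X]setTI; apply: measurable_fst => //.
exact: measurable_weight_box.
Qed.

Lemma scaled_tailE v x y : 0 < v.1 -> 0 < v.2 ->
  Pr P [set s | scaled_tail x y (v, pair_map X Y s)] = H (x / v.1) (y / v.2).
Proof.
move=> v1 v2; rewrite /jtail; congr (Pr P _); apply/seteqP.
by split=> s /=; rewrite !ltr_pdivrMr// ![X s * _]mulrC ![Y s * _]mulrC.
Qed.

Lemma boxed_tail_le a x y x' y' K : 0 <= a -> 0 <= K ->
  (forall v1 v2, a < v1 <= B -> a < v2 <= B ->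
     H (x / v1) (y / v2) <= K * H (x' / v1) (y' / v2)) ->
  Pr P [set t | weight_box a (theta t, delta t) /\
    (theta t * X t > x /\ delta t * Y t > y)] <= K * A x' y'.
Proof.
move=> a0 K0 HK.
apply: (mixture_le indep (measurable_boxed_tail a x y)
  (measurable_scaled_tail x' y') K0) => v.
have [[v1 v2]|nv] := pselect (weight_box a v); last first.
  rewrite (_ : [set s | _] = set0).
    by rewrite Pr0 mulr_ge0// Pr_ge0.
  by apply/seteqP; split=> // s [].
have [v10 v20] : 0 < v.1 /\ 0 < v.2 by split; lra.
rewrite scaled_tailE//; apply: le_trans (HK _ _ v1 v2).
rewrite -scaled_tailE//; apply: Pr_le; last by move=> s [].
  exact: (measurable_section_event (pair_map X Y) v (measurable_boxed_tail a x y)).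
exact: (measurable_section_event (pair_map X Y) v (measurable_scaled_tail x y)).
Qed.

Let measurable_joint (G : set (R * R)) x y : measurable G ->
  measurable [set t | G (theta t, delta t) /\
    (theta t * X t > x /\ delta t * Y t > y)].
Proof.
move=> mG; rewrite (_ : [set t | _] = pair_map theta delta @^-1` G `&`
  [set t | (theta \* X) t > x /\ (delta \* Y) t > y])//.
apply: measurableI; last exact: measurable_jgt.
by rewrite -[X in measurable X]setTI; exact: (measurable_pair_map theta delta).
Qed.

Lemma weighted_tail_le_boxed x y : 0 <= x -> 0 <= y ->
  A x y <= Pr P [set t | weight_box 0 (theta t, delta t) /\
    (theta t * X t > x /\ delta t * Y t > y)].
Proof.
move=> x0 y0; apply: Pr_le_off_null.
- exact: measurable_jgt.
- by apply: measurable_joint; exact: measurable_weight_box.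
move=> t tB dB [/= xt yt]; split=> //.
have th0 : 0 < theta t by exact: (mulr_gt_pos (w := X t) xt).
have de0 : 0 < delta t by exact: (mulr_gt_pos (w := Y t) yt).
by rewrite /weight_box/= tB dB th0 de0.
Qed.

(** Since the weights are bounded, an event on the weights acts on the joint
    tail of the product as a factor, up to a change of scale. *)
Lemma weight_event_tail_le (G : set (R * R)) x y : measurable G ->
  0 <= x -> 0 <= y ->
  Pr P [set t | G (theta t, delta t) /\
    (theta t * X t > x /\ delta t * Y t > y)] <=
  Pr P [set t | G (theta t, delta t)] * H (B^-1 * x) (B^-1 * y).
Proof.
move=> mG x0 y0.
pose J := [set w : R * R | w.1 > B^-1 * x /\ w.2 > B^-1 * y].
have mJ : measurable J.
  by apply: measurable_jgt; [exact: measurable_fst|exact: measurable_snd].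
rewrite -[X in _ <= X * _]/(Pr P (pair_map theta delta @^-1` G)).
rewrite -[X in _ <= _ * X]/(Pr P (pair_map X Y @^-1` J)).
rewrite -Pr_independent//; apply: Pr_le_off_null.
- exact: measurable_joint.
- by apply: measurableI; rewrite -[X in measurable X]setTI;
    [exact: (measurable_pair_map theta delta)|exact: (measurable_pair_map X Y)].
move=> t tB dB [Gt [xt yt]]; split=> //.
by split => /=; [exact: (lt_of_lt_weighted (z := theta t))
  |exact: (lt_of_lt_weighted (z := delta t))].
Qed.

Section given_scale_bounded.
Hypothesis H_bounded : scale_bounded H.

(** The two weights exceed some [h > 0] with positive probability, and there the
    tail of the product is at least that of the claims at scale [h^-1]. *)
Lemma weighted_tail_ge x0 y0 : 0 <= x0 -> 0 <= y0 -> 0 < A x0 y0 ->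
  exists2 c, 0 < c & \forall z \near oo2 R, c * H z.1 z.2 <= A z.1 z.2.
Proof.
move=> x00 y00 A0.
pose G h := [set v : R * R | v.1 > h /\ v.2 > h].
have mG h : measurable (pair_map theta delta @^-1` G h).
  exact: (@measurable_jgt _ _ _ theta delta).
have G0 : 0 < Pr P (pair_map theta delta @^-1` G 0).
  apply: (lt_le_trans A0); apply: Pr_le => //; first exact: measurable_jgt.
  move=> t [/= xt yt]; split => /=.
    exact: (mulr_gt_pos (w := X t) xt).
  exact: (mulr_gt_pos (w := Y t) yt).
(* A third for each of the two events that a weight is positive but small
   leaves something for the event that both exceed [h]. *)
have p2 : 0 < Pr P (pair_map theta delta @^-1` G 0) / 3 by rewrite divr_gt0.
have [h [/andP[h0 h1] th de]] : exists h, [/\ 0 < h < 1,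
    Pr P [set t | 0 < theta t <= h] < Pr P (pair_map theta delta @^-1` G 0) / 3 &
    Pr P [set t | 0 < delta t <= h] < Pr P (pair_map theta delta @^-1` G 0) / 3].
  near (0 : R)^'+ => h; exists h; split.
  - by apply/andP; split; near: h; [exact: nbhs_right_gt|exact: nbhs_right_lt].
  - by near: h; exact: Pr_small_positive.
  - by near: h; exact: Pr_small_positive.
pose p := Pr P (pair_map theta delta @^-1` G h).
have mI (Z : {RV P >-> R}) : measurable [set t | 0 < Z t <= h].
  exact: measurable_gt_le.
have p0 : 0 < p.
  have : Pr P (pair_map theta delta @^-1` G 0) <=
      p + (Pr P [set t | 0 < theta t <= h] + Pr P [set t | 0 < delta t <= h]).
    apply: le_trans (lerD (lexx _) (Pr_setU_le P (mI theta) (mI delta))).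
    apply: Pr_subset_setU => //; first exact: measurableU.
    move=> t [/= t0 d0].
    have [th'|th'] := leP (theta t) h; first by right; left; rewrite /= t0.
    have [de'|de'] := leP (delta t) h; first by right; right; rewrite /= d0.
    by left.
  lra.
have [C C0 HC] := H_bounded (introT andP (conj h0 h1)).
exists (p / C); first by rewrite divr_gt0.
have hy : h^-1 * x @[x --> +oo] --> +oo by apply: scale_cvgy; rewrite invr_gt0.
have := near_oo2_comp hy hy HC; apply: filterS2 (near_oo2_gt 0) => -[x y] /= [x1 y1].
rewrite !mulrA mulfV ?gt_eqF// !mul1r => Hxy.
rewrite mulrAC ler_pdivrMr//.
apply: (@le_trans _ _ (p * (C * H (h^-1 * x) (h^-1 * y)))).
  by rewrite ler_pM2l.
rewrite mulrCA mulrC ler_pM2r//.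
pose J := [set w : R * R | w.1 > h^-1 * x /\ w.2 > h^-1 * y].
have mJ : measurable J.
  by apply: measurable_jgt; [exact: measurable_fst|exact: measurable_snd].
rewrite -[X in _ * X <= _]/(Pr P (pair_map X Y @^-1` J)) /p.
rewrite -Pr_independent//; last first.
  by apply: measurable_jgt; [exact: measurable_fst|exact: measurable_snd].
apply: Pr_le; [|exact: measurable_jgt|].
  by apply: measurableI => //; rewrite -[X in measurable X]setTI;
    exact: (measurable_pair_map X Y).
move=> t [[/= th1 de1] [/= X1 Y1]].
have key z w u : h < z -> 0 < u -> h^-1 * u < w -> u < z * w.
  move=> hz u0; rewrite ltr_pdivrMl// => uhw.
  have w0 : 0 < w by move: (lt_trans u0 uhw); rewrite pmulr_rgt0.
  by rewrite (lt_trans uhw)// ltr_pM2r.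
by split; exact: key.
Unshelve. all: by end_near. Qed.

Section given_comparison.
Variable c : R.
Hypotheses (c_gt0 : 0 < c)
           (cHA : \forall z \near oo2 R, c * H z.1 z.2 <= A z.1 z.2).

Lemma tail_le_weighted b : 0 < b < 1 -> exists2 K, 0 < K &
  \forall z \near oo2 R, H (b * z.1) (b * z.2) <= K * A z.1 z.2.
Proof.
move=> /H_bounded[C C0 HC]; exists (C / c); first by rewrite divr_gt0.
apply: filterS2 HC cHA => z HC HA; apply: (le_trans HC).
by rewrite -mulrA ler_pM2l// ler_pdivlMl.
Qed.

Lemma weighted_scale_insensitive : scale_insensitive H -> scale_insensitive A.
Proof.
move=> iH e e0; have [k k01 Hk] := iH e e0.
exists k => //; have /andP[k0 k1] := k01.
have /near_oo2P[M M0 HM] := Hk.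
apply/near_oo2P; exists (B * M); first by rewrite mulr_ge0// ltW.
move=> x y /= Mx My.
have x0 : 0 < x by rewrite (le_lt_trans _ Mx)// mulr_ge0// ltW.
have y0 : 0 < y by rewrite (le_lt_trans _ My)// mulr_ge0// ltW.
have kx0 : 0 <= k * x by rewrite mulr_ge0// ltW.
have ky0 : 0 <= k * y by rewrite mulr_ge0// ltW.
apply: (le_trans (weighted_tail_le_boxed kx0 ky0)).
apply: boxed_tail_le => //; first by rewrite addr_ge0// ltW.
move=> v1 v2 /andP[v10 v1B] /andP[v20 v2B]; rewrite -!mulrA.
have key v u : 0 < v -> v <= B -> B * M < u -> M < u / v.
  move=> v0 vB Mu; rewrite ltr_pdivlMr// (le_lt_trans _ Mu)// mulrC.
  by rewrite ler_wpM2r.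
by apply: (HM (x / v1) (y / v2)); exact: key.
Qed.

(** For a weight above [h], shifting the threshold of the product by [L] shifts
    that of the claim by at most [L / h], which is harmless. Positive weights
    below [h] have a small probability, hence a small contribution. *)
Lemma weighted_shift_insensitive : shift_insensitive H -> shift_insensitive A.
Proof.
move=> iH e L e0 L0.
have [K K0 HK] : exists2 K, 0 < K & \forall z \near oo2 R,
    H ((2 * B)^-1 * z.1) ((2 * B)^-1 * z.2) <= K * A z.1 z.2.
  have B2 : 1 < 2 * B by rewrite (lt_trans B_gt1)// ltr_pMl// ltr1n.
  by apply: tail_le_weighted; rewrite invr_gt0 invf_lt1 ?B2 (lt_trans ltr01 B2).
(* Small positive weights are charged to the factor [e / 2]. *)
have eK : 0 < e / (4 * K) by rewrite divr_gt0// mulr_gt0.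
have [h [h0 th de]] : exists h, [/\ 0 < h,
    Pr P [set t | 0 < theta t <= h] < e / (4 * K) &
    Pr P [set t | 0 < delta t <= h] < e / (4 * K)].
  near (0 : R)^'+ => h; exists h; split.
  - by near: h; exact: nbhs_right_gt.
  - by near: h; exact: Pr_small_positive.
  - by near: h; exact: Pr_small_positive.
have e2 : 0 < e / 2 by rewrite divr_gt0.
have /near_oo2P[M M0 HM] : \forall z \near oo2 R,
    H (z.1 - L / h) (z.2 - L / h) <= (1 + e / 2) * H z.1 z.2.
  by apply: iH => //; rewrite divr_ge0// ltW.
pose small := [set v : R * R | 0 < v.1 <= h \/ 0 < v.2 <= h].
have m1 : measurable [set v : R * R | 0 < v.1 <= h].
  by apply: measurable_gt_le; exact: measurable_fst.
have m2 : measurable [set v : R * R | 0 < v.2 <= h].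
  by apply: measurable_gt_le; exact: measurable_snd.
have msmall : measurable small by exact: measurableU.
have pre (G : set (R * R)) : measurable G ->
    measurable [set t | G (theta t, delta t)].
  by move=> mG; rewrite -[X in measurable X]setTI;
    exact: (measurable_pair_map theta delta).
have Psmall : Pr P [set t | small (theta t, delta t)] <= e / 2 / K.
  apply: le_trans (Pr_subset_setU P (pre _ msmall) (pre _ m1) (pre _ m2) _) _ => //.
  apply/ltW/(lt_le_trans (ltrD th de)).
  by have -> : e / (4 * K) + e / (4 * K) = e / 2 / K by field; rewrite gt_eqF.
near=> z; have [zL1 zL2] : 2 * L < z.1 /\ 2 * L < z.2.
  by near: z; exact: near_oo2_gt.
have [zM1 zM2] : B * M < z.1 /\ B * M < z.2 by near: z; exact: near_oo2_gt.
have x0 : 0 <= z.1 - L by lra.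
have y0 : 0 <= z.2 - L by lra.
have mboxh := measurable_weight_box h.
have mbox0 := measurable_weight_box 0.
apply: (le_trans (weighted_tail_le_boxed x0 y0)).
apply: (@le_trans _ _ (
  Pr P [set t | weight_box h (theta t, delta t) /\
    (theta t * X t > z.1 - L /\ delta t * Y t > z.2 - L)] +
  Pr P [set t | small (theta t, delta t) /\
    (theta t * X t > z.1 - L /\ delta t * Y t > z.2 - L)])).
  apply: Pr_subset_setU; [exact: measurable_joint..|].
  move=> t [[/= /andP[t0 tB] /andP[d0 dB]] big].
  have [th'|th'] := leP (theta t) h; first by right; split=> //; left; rewrite /= t0.
  have [de'|de'] := leP (delta t) h; first by right; split=> //; right; rewrite /= d0.
  by left; split=> //; split; rewrite /= ?th' ?de'.
rewrite (_ : 1 + e = (1 + e / 2) + e / 2); last by lra.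
rewrite mulrDl; apply: lerD.
  apply: boxed_tail_le; [exact: ltW|by lra|].
  move=> v1 v2 /andP[v1h v1B] /andP[v2h v2B].
  have key v u : h < v -> v <= B -> B * M < u -> M < u / v.
    move=> v0 vB Mu; rewrite ltr_pdivlMr ?(lt_trans h0)// (le_lt_trans _ Mu)// mulrC.
    by rewrite ler_wpM2r.
  have shift v u : h < v -> u / v - L / h <= (u - L) / v.
    move=> hv; rewrite mulrBl lerD2l lerN2 ler_wpM2l// lef_pV2 ?posrE ?ltW//.
    exact: lt_trans hv.
  apply: (le_trans _ (HM (z.1 / v1) (z.2 / v2) _ _)); [|exact: key..].
  by apply: H_antitone; exact: shift.
apply: (le_trans (weight_event_tail_le msmall x0 y0)).
apply: (@le_trans _ _ (e / 2 / K * (K * A z.1 z.2))); last first.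
  by rewrite mulrA divfK// gt_eqF.
apply: ler_pM => //; [exact: Pr_ge0|exact: jtail_ge0|].
apply: (@le_trans _ _ (H ((2 * B)^-1 * z.1) ((2 * B)^-1 * z.2))).
  rewrite invfM; apply: H_antitone; rewrite mulrAC mulrC ler_pM2l ?invr_gt0//; lra.
by near: z.
Unshelve. all: by end_near. Qed.

End given_comparison.
End given_scale_bounded.
End weighted_pair.

(** * Breiman asymptotics *)

Lemma cvg_oo2 (R : realType) (u v : R^nat) :
  u n @[n --> \oo] --> +oo -> v n @[n --> \oo] --> +oo ->
  (u n, v n) @[n --> \oo] --> oo2 R.
Proof.
move=> uy vy Q [[Q1 Q2] /= [Q1y Q2y] QQ].
have Quv : \forall n \near \oo, Q1 (u n) /\ Q2 (v n).
  by apply: filterI; [exact: uy|exact: vy].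
by apply: filterS Quv => n [? ?]; exact: (QQ (u n, v n)).
Qed.

(** Dominated convergence is a statement about sequences; this reduces the
    filter of large arguments to them. *)
Lemma cvg_oo2_seq (R : realType) (f : R * R -> R) (l : R) :
  (forall u v : R^nat, u n @[n --> \oo] --> +oo -> v n @[n --> \oo] --> +oo ->
     f (u n, v n) @[n --> \oo] --> l) ->
  f z @[z --> oo2 R] --> l.
Proof.
move=> fl; apply/cvgrPdist_lt => e e0; apply: contrapT => nnear.
have ex n : exists z : R * R, (n%:R < z.1 /\ n%:R < z.2) /\ ~ `|l - f z| < e.
  apply: contrapT => nex; apply: nnear; apply/near_oo2P; exists n%:R => // x y nx ny.
  by apply: contrapT => far; apply: nex; exists (x, y).
have [w wP] := choice ex.
have key (g : R * R -> R) : (forall n, n%:R < g (w n)) -> g (w n) @[n --> \oo] --> +oo.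
  move=> gw; apply/cvgryPge => a; near=> n; apply: le_trans (ltW (gw n)).
  by near: n; exact: nbhs_infty_ger.
have := fl _ _ (key fst (fun n => (wP n).1.1)) (key snd (fun n => (wP n).1.2)).
move=> /cvgrPdist_lt/(_ e e0)[n _ /(_ n (leqnn _))] /=.
by have [_] := wP n; rewrite -surjective_pairing.
Unshelve. all: by end_near. Qed.

Section breiman.
Context d (T : measurableType d) (R : realType) (P : probability T R).
Variables theta delta X Y : {RV P >-> R}.
Hypotheses (theta_ge0 : forall t, 0 <= theta t)
           (delta_ge0 : forall t, 0 <= delta t).
Hypothesis indep : independent_maps P (pair_map theta delta) (pair_map X Y).
Variable B : R.
Hypotheses (B_gt1 : 1 < B)
           (theta_le : Pr P [set t | theta t > B] = 0)
           (delta_le : Pr P [set t | delta t > B] = 0).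
Variables a1 a2 : R.
Hypotheses (a1_gt0 : 0 < a1) (a2_gt0 : 0 < a2).
Hypothesis R2 : class_R2 P a1 a2 X Y.

Local Notation H := (jtail P X Y).
Local Notation A := (jtail P (theta \* X) (delta \* Y)).

Let section_tail x y t : R :=
  Pr P [set s | scaled_tail x y ((theta t, delta t), pair_map X Y s)].

Let limit_weight t : R := theta t `^ a1 * delta t `^ a2.

Let section_tail0 x y t : 0 <= x -> 0 <= y ->
  ~ (0 < theta t /\ 0 < delta t) -> section_tail x y t = 0.
Proof.
move=> x0 y0 n0; rewrite /section_tail (_ : [set s | _] = set0) ?Pr0//.
apply/seteqP; split=> // s [/= xs ys]; apply: n0.
by split; [exact: (mulr_gt_pos (w := X s) xs)|exact: (mulr_gt_pos (w := Y s) ys)].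
Qed.

Let limit_weight0 t : ~ (0 < theta t /\ 0 < delta t) -> limit_weight t = 0.
Proof.
rewrite /limit_weight; have [->|t0] := eqVneq (theta t) 0.
  by rewrite powR0 ?gt_eqF// mul0r.
have [->|d0] := eqVneq (delta t) 0; first by rewrite powR0 ?gt_eqF// mulr0.
by case; rewrite !lt_neqAle ![0 == _]eq_sym t0 d0 theta_ge0 delta_ge0.
Qed.

Let section_tail_cvg (u v : R^nat) t :
  u n @[n --> \oo] --> +oo -> v n @[n --> \oo] --> +oo ->
  section_tail (u n) (v n) t / H (u n) (v n) @[n --> \oo] --> limit_weight t.
Proof.
move=> uy vy.
have uvy : (u n, v n) @[n --> \oo] --> oo2 R by exact: cvg_oo2.
have [[t0 d0]|n0] := pselect (0 < theta t /\ 0 < delta t).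
  have [_ _ /(_ (theta t)^-1 (delta t)^-1)] := R2.
  rewrite !invr_gt0 => /(_ t0 d0)[_ R2t].
  have -> : limit_weight t = (theta t)^-1 `^ (- a1) * (delta t)^-1 `^ (- a2).
    by rewrite -!powR_inv1 ?ltW// -!powRrM !mulN1r !opprK.
  have uvR2 : H ((theta t)^-1 * u n) ((delta t)^-1 * v n) / H (u n) (v n)
      @[n --> \oo] --> (theta t)^-1 `^ (- a1) * (delta t)^-1 `^ (- a2).
    exact: cvg_comp uvy R2t.
  apply: cvg_trans uvR2; apply: near_eq_cvg; near=> n.
 rewrite /section_tail (scaled_tailE X Y)//=.
  by rewrite ![(_)^-1 * _]mulrC.
rewrite limit_weight0//; apply: cvg_near_cst; near=> n.
rewrite section_tail0 ?mul0r//; near: n.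
  by have /cvgryPge := uy; exact.
by have /cvgryPge := vy; exact.
Unshelve. all: by end_near. Qed.

Let section_tail_le : exists2 C : R, 0 < C &
  \forall z \near oo2 R, forall t, theta t <= B -> delta t <= B ->
    section_tail z.1 z.2 t / H z.1 z.2 <= C.
Proof.
have aH : antitone2 H by exact: jtail_antitone.
have B0 : 0 < B by rewrite (lt_trans ltr01).
have B01 : 0 < B^-1 < 1 by rewrite invr_gt0 B0 invf_lt1.
have iH := class_R2_scale_insensitive a1_gt0 a2_gt0 R2.
have [C C0 HC] := scale_insensitive_bounded aH iH B01.
have Hpos := class_R2_jtail_pos R2.
exists C => //; near=> z => t tB dB.
have [x0 y0] : 0 < z.1 /\ 0 < z.2 by near: z; exact: near_oo2_gt.
rewrite ler_pdivrMr; last by near: z.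
have [[t0 d0]|n0] := pselect (0 < theta t /\ 0 < delta t); last first.
  by rewrite (section_tail0 (ltW x0) (ltW y0))// mulr_ge0 ?jtail_ge0// ltW.
rewrite /section_tail (scaled_tailE X Y)//=.
apply: (@le_trans _ _ (H (B^-1 * z.1) (B^-1 * z.2))); last by near: z.
by apply: aH; rewrite mulrC ler_pM2l// lef_pV2.
Unshelve. all: by end_near. Qed.

(** Dominated convergence along sequences: given the weights, the ratio of the
    tails converges by regular variation, and it is bounded since the weights
    are. *)
Lemma weighted_tail_cvg :
  A z.1 z.2 / H z.1 z.2 @[z --> oo2 R] -->
  fine 'E_P[fun t => theta t `^ a1 * delta t `^ a2].
Proof.
apply: cvg_oo2_seq => u v uy vy /=.
have uvy : (u n, v n) @[n --> \oo] --> oo2 R by exact: cvg_oo2.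
have [C C0 HC] := section_tail_le.
have [N _ HN] := uvy _ (filterI HC (class_R2_jtail_pos R2)).
rewrite -(cvg_shiftn N).
pose f_ n t : \bar R := (((H (u (n + N)%N) (v (n + N)%N))^-1)%:E *
  P [set s | scaled_tail (u (n + N)%N) (v (n + N)%N)
               ((theta t, delta t), pair_map X Y s)])%E.
have mS n := @measurable_scaled_tail R (u n) (v n).
have f_E n t : f_ n t =
    (section_tail (u (n + N)%N) (v (n + N)%N) t / H (u (n + N)%N) (v (n + N)%N))%:E.
  rewrite /f_ PrE -?EFinM 1?mulrC//.
  exact: (measurable_section_event (pair_map X Y) _ (mS _)).
have mf_ n : measurable_fun setT (f_ n).
  apply: measurable_funeM.
  exact: (measurable_section_prob P (pair_map theta delta) (pair_map X Y) (mS (n + N)%N)).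
have mf : measurable_fun setT (fun t => (limit_weight t)%:E).
  apply/measurable_EFinP; apply: measurable_funM.
    by apply: (measurableT_comp (measurable_powR _)); exact: measurable_funPT.
  by apply: (measurableT_comp (measurable_powR _)); exact: measurable_funPT.
have f_f : {ae P, forall t, setT t -> f_ ^~ t @ \oo --> (limit_weight t)%:E}.
  apply: aeW => t _; under eq_fun do rewrite f_E.
  apply: cvg_EFin; first by apply: nearW.
  by have := @section_tail_cvg u v t uy vy; rewrite -(cvg_shiftn N).
have ig : P.-integrable setT (EFin \o cst C).
  exact: finite_measure_integrable_cst.
have ae_le (Z : {RV P >-> R}) : Pr P [set t | Z t > B] = 0 ->
    {ae P, forall t, Z t <= B}.
  move=> Z0; exists [set t | Z t > B]; split.
  - exact: measurable_gt.
  - by rewrite PrE ?Z0//; exact: measurable_gt.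
  - by move=> t /= /negP; rewrite ltNge.
have f_g : {ae P, forall t n, setT t -> (`|f_ n t| <= (EFin \o cst C) t)%E}.
  apply: filterS2 (ae_le _ theta_le) (ae_le _ delta_le) => t tB dB n _.
  have [/= HCn Hpos] := HN _ (leq_addl n N).
  rewrite f_E abse_EFin lee_fin ger0_norm; first exact: HCn.
  by rewrite divr_ge0// ?Pr_ge0// ltW.
have [int_f _] := dominated_convergence measurableT mf_ mf f_f ig f_g.
have EE : (\int[P]_t (limit_weight t)%:E = 'E_P[limit_weight])%E by rewrite unlock.
have Efin : ('E_P[limit_weight])%E \is a fin_num.
  by rewrite -EE; exact: integrable_fin_num.
rewrite EE -(fineK Efin) => /fine_cvg lim.
apply: cvg_trans lim; apply: near_eq_cvg; apply: nearW => n /=.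
have A_E : P [set t | scaled_tail (u (n + N)%N) (v (n + N)%N)
    (pair_map theta delta t, pair_map X Y t)] = (A (u (n + N)%N) (v (n + N)%N))%:E.
  by rewrite PrE//; exact: measurable_pair_event.
rewrite /f_ ge0_integralZl//.
- rewrite -(mixture indep (mS _)) A_E fineM// mulrC//.
- exact: (measurable_section_prob P (pair_map theta delta) (pair_map X Y) (mS _)).
- by rewrite lee_fin invr_ge0 jtail_ge0.
Qed.

(** The expectation is positive since it is at least [c]; this is what turns the
    convergence of the ratio into an equivalence. *)
Lemma weighted_tail_breiman c : 0 < c ->
  (\forall z \near oo2 R, c * H z.1 z.2 <= A z.1 z.2) ->
  asymp_equiv (oo2 R) (fun z => A z.1 z.2)
    (fun z => fine 'E_P[fun t => theta t `^ a1 * delta t `^ a2] * H z.1 z.2).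
Proof.
move=> c0 cHA; set E := fine _.
have AHE : A z.1 z.2 / H z.1 z.2 @[z --> oo2 R] --> E by exact: weighted_tail_cvg.
have Hpos := class_R2_jtail_pos R2.
have E0 : 0 < E.
  rewrite (lt_le_trans c0)// leNgt; apply/negP => Ec.
  have [z [zlt [zle zpos]]] := filter_ex (filterI
    (ratio_cvg_le (conj Hpos AHE) (midf_lt Ec).1) (filterI cHA Hpos)).
  have := le_trans zle zlt; rewrite ler_pM2r// leNgt => /negP; apply.
  exact: (midf_lt Ec).2.
split; first by apply: filterS Hpos => z; exact: mulr_gt0.
have lim : A z.1 z.2 / H z.1 z.2 / E @[z --> oo2 R] --> (1 : R).
  rewrite -(mulfV (lt0r_neq0 E0)); apply: cvgMl => //; exact: AHE.
apply: cvg_trans lim; apply: near_eq_cvg; apply: nearW => z /=.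
by rewrite invfM mulrAC mulrA.
Qed.

End breiman.

(** * Ruin asymptotics with bounded weights *)

Lemma near_oo2_swap (R : realType) (Q : R * R -> Prop) :
  (\forall z \near oo2 R, Q z) -> \forall z \near oo2 R, Q (z.2, z.1).
Proof.
move=> /near_oo2P[M M0 MQ]; apply/near_oo2P; exists M => // x y Mx My.
exact: MQ.
Qed.

Lemma jtailC d (T : measurableType d) (R : realType) (P : probability T R)
  (U V : T -> R) x y : jtail P U V x y = jtail P V U y x.
Proof. by rewrite /jtail; congr (Pr P _); apply/seteqP; split=> t /= [? ?]. Qed.

(** A product exceeding [u] whose weight is at most [B] has a claim exceeding
    [u / B]; weights above [B] have probability zero. *)
Lemma extra_jump_weighted_le d (T : measurableType d) (R : realType)
    (P : probability T R) (n : nat) (Theta Delta X Y : 'I_n -> {RV P >-> R})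
    (B : R) (l x y : R) (i k j : 'I_n) :
  (forall i t, 0 <= Theta i t) -> (forall j t, 0 <= Delta j t) -> 1 < B ->
  (forall i, Pr P [set t | Theta i t > B] = 0) ->
  (forall j, Pr P [set t | Delta j t > B] = 0) ->
  0 <= l -> 0 <= x -> 0 <= y ->
  Pr P (extra_jump (fun i => Theta i \* X i) (fun j => Delta j \* Y j)
          l x y i k j) <=
  Pr P (extra_jump X Y (B^-1 * l) (B^-1 * x) (B^-1 * y) i k j).
Proof.
move=> Th0 De0 B1 ThB DeB l0 x0 y0.
have B0 : 0 < B by rewrite (lt_trans ltr01).
have mTh k' : measurable [set t | Theta k' t > B] by exact: measurable_gt.
have mDe k' : measurable [set t | Delta k' t > B] by exact: measurable_gt.
have mE : measurable (extra_jump X Y (B^-1 * l) (B^-1 * x) (B^-1 * y) i k j).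
  by apply: measurable_extra_jump => ?; exact: measurable_funPT.
rewrite -[leRHS]addr0 -{1}(ThB k) -[leRHS]addr0 -{1}(ThB i) -[leRHS]addr0 -{1}(DeB j).
have mU1 : measurable (extra_jump X Y (B^-1 * l) (B^-1 * x) (B^-1 * y) i k j `|`
   [set t | Theta k t > B]) by exact: measurableU.
have mU2 : measurable (extra_jump X Y (B^-1 * l) (B^-1 * x) (B^-1 * y) i k j `|`
   [set t | Theta k t > B] `|` [set t | Theta i t > B]) by exact: measurableU.
apply: le_trans (lerD (lerD (Pr_setU_le P mE (mTh k)) (lexx _)) (lexx _)).
apply: le_trans (lerD (Pr_setU_le P mU1 (mTh i)) (lexx _)).
apply: (Pr_subset_setU _ _ mU2 (mDe j)).
  by apply: measurable_extra_jump => ?; exact: measurable_funM.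
move=> t [/= lt xt yt].
have [kB|kB] := leP (Theta k t) B; last by left; left; right.
have [iB|iB] := leP (Theta i t) B; last by left; right.
have [jB|jB] := leP (Delta j t) B; last by right.
left; left; left; split=> /=.
- apply: (lt_of_lt_weighted B0 (Th0 k t) kB l0).
  by rewrite -[X in X * _](ger0_norm (Th0 k t)) -normrM.
- exact: (lt_of_lt_weighted B0 (Th0 i t) iB x0).
- exact: (lt_of_lt_weighted B0 (De0 j t) jB y0).
Qed.

Section extra_jumps.
Context d (T : measurableType d) (R : realType) (P : probability T R) (n : nat).
Variables Theta Delta X Y : 'I_n -> {RV P >-> R}.
Hypothesis n_gt0 : (0 < n)%N.
Hypotheses (Theta_ge0 : forall i t, 0 <= Theta i t)
           (Delta_ge0 : forall j t, 0 <= Delta j t).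
Variable B : R.
Hypotheses (B_gt1 : 1 < B)
           (Theta_le : forall i, Pr P [set t | Theta i t > B] = 0)
           (Delta_le : forall j, Pr P [set t | Delta j t > B] = 0).

Local Notation U := (fun i => Theta i \* X i).
Local Notation V := (fun j => Delta j \* Y j).
Local Notation H i j := (jtail P (X i) (Y j)).
Local Notation A i j := (jtail P (Theta i \* X i) (Delta j \* Y j)).

Hypothesis tail_le : forall i j b, 0 < b < 1 -> exists2 K, 0 < K &
  \forall z \near oo2 R, H i j (b * z.1) (b * z.2) <= K * A i j z.1 z.2.

Let n0 : 0 < n%:R :> R. Proof. by rewrite ltr0n. Qed.

Let n1 : 1 <= n%:R :> R. Proof. by rewrite ler1n. Qed.

Let B0 : 0 < B. Proof. by rewrite (lt_trans ltr01). Qed.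

Let b01 : 0 < (B * n%:R)^-1 < 1.
Proof.
have Bn : 1 < B * n%:R by rewrite (lt_le_trans B_gt1)// ler_peMr// ltW.
by rewrite invr_gt0 invf_lt1 ?Bn (lt_trans ltr01 Bn).
Qed.

Let b_cvgy : (B * n%:R)^-1 * x @[x --> +oo] --> +oo.
Proof. by apply: scale_cvgy; case/andP: b01. Qed.

Let thresholdE (x : R) : B^-1 * (x / n%:R) = (B * n%:R)^-1 * x.
Proof. by rewrite invfM mulrAC mulrA. Qed.

(** The condition on the claims bounds the extra jump by a small multiple of
    the joint tail at smaller thresholds, and the change of thresholds costs
    only the constant [K]. *)
Lemma extra_jump_GTAI_le i k j e : GTAI_half X Y -> k != i -> 0 < e ->
  \forall L \near +oo, \forall z \near oo2 R,
    Pr P (extra_jump U V (L / n%:R) (z.1 / n%:R) (z.2 / n%:R) i k j)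
      <= e * A i j z.1 z.2.
Proof.
move=> gXY ki e0; have [K K0 HK] := tail_le i j b01.
have eK : 0 < e / K by rewrite divr_gt0.
have near_L := near_oo3_comp b_cvgy b_cvgy b_cvgy
  (ratio_cvg_le (gXY k i j ki) eK).
near=> L.
have L0 : 0 < L by near: L; exact: nbhs_pinfty_gt (num_real _).
have nL : \forall z \near oo2 R, Pr P ([set t | `|X k t| > (B * n%:R)^-1 * L] `&`
    [set t | X i t > (B * n%:R)^-1 * z.1 /\ Y j t > (B * n%:R)^-1 * z.2]) <=
    e / K * H i j ((B * n%:R)^-1 * z.1) ((B * n%:R)^-1 * z.2).
  by near: L; exact: near_L.
near=> z; have [z1 z2] : 0 < z.1 /\ 0 < z.2 by near: z; exact: near_oo2_gt.
apply: (le_trans (@extra_jump_weighted_le _ _ _ P n Theta Delta X Y B _ _ _ i k j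
  Theta_ge0 Delta_ge0 B_gt1 Theta_le Delta_le _ _ _));
  rewrite ?divr_ge0 ?(ltW n0) ?(ltW L0) ?(ltW z1) ?(ltW z2)//.
rewrite !thresholdE.
apply: (@le_trans _ _ (e / K * (K * A i j z.1 z.2))); last first.
  by rewrite mulrA divfK ?gt_eqF.
apply: (@le_trans _ _ (e / K * H i j ((B * n%:R)^-1 * z.1) ((B * n%:R)^-1 * z.2))).
  rewrite (_ : extra_jump _ _ _ _ _ _ _ _ =
    [set t | `|X k t| > (B * n%:R)^-1 * L] `&`
    [set t | X i t > (B * n%:R)^-1 * z.1 /\ Y j t > (B * n%:R)^-1 * z.2]).
    by near: z.
  by apply/seteqP; split=> t [] // ? [].
by rewrite ler_pM2l//; near: z.
Unshelve. all: by end_near. Qed.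

(** The same argument, all thresholds being first lowered to the smallest one,
    since the condition on the claims has a common threshold for the two terms
    of a line. *)
Lemma extra_jump_GQAI_le i k j c e :
  (forall e', 0 < e' -> \forall z \near oo2 R,
    Pr P (extra_jump X Y z.1 z.1 z.2 i k j) <=
      e' * (H k j z.1 z.2 + H i j z.1 z.2)) ->
  0 < c < 1 -> 0 < e ->
  \forall z \near oo2 R,
    Pr P (extra_jump U V (c * z.1 / n%:R) (z.1 / n%:R) (z.2 / n%:R) i k j)
      <= e * (A k j z.1 z.2 + A i j z.1 z.2).
Proof.
move=> gXY /andP[c0 c1] e0; have /andP[b0 b1] := b01.
have cb01 : 0 < c * (B * n%:R)^-1 < 1 by rewrite mulr_gt0//= mulr_ilt1// ltW.
have [K K0 HK] := tail_le k j cb01; have [K' K'0 HK'] := tail_le i j cb01.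
have KK : 0 < Num.max K K' by rewrite lt_max K0.
have eK : 0 < e / Num.max K K' by rewrite divr_gt0.
have cb_cvgy := scale_cvgy (proj1 (andP cb01)).
have HXY := near_oo2_comp cb_cvgy cb_cvgy (gXY _ eK).
near=> z; have [z1 z2] : 0 < z.1 /\ 0 < z.2 by near: z; exact: near_oo2_gt.
have cz1 : 0 < c * z.1 by rewrite mulr_gt0.
apply: (le_trans (@extra_jump_weighted_le _ _ _ P n Theta Delta X Y B _ _ _ i k j
  Theta_ge0 Delta_ge0 B_gt1 Theta_le Delta_le _ _ _));
  rewrite ?divr_ge0 ?(ltW n0) ?(ltW cz1) ?(ltW z1) ?(ltW z2)//.
rewrite !thresholdE [_ * (c * _)]mulrCA mulrA.
have shrink u : 0 < u -> c * (B * n%:R)^-1 * u <= (B * n%:R)^-1 * u.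
  by move=> u0; rewrite ler_pM2r// ler_piMl ?ltW.
apply: (@le_trans _ _ (Pr P (extra_jump X Y (c * (B * n%:R)^-1 * z.1)
    (c * (B * n%:R)^-1 * z.1) (c * (B * n%:R)^-1 * z.2) i k j))).
  apply: Pr_le; [exact: measurable_extra_jump..|].
  move=> t [Xk Xi Yj]; split=> //; first exact: le_lt_trans (shrink _ z1) Xi.
  exact: le_lt_trans (shrink _ z2) Yj.
apply: (@le_trans _ _ (e / Num.max K K' *
    (H k j (c * (B * n%:R)^-1 * z.1) (c * (B * n%:R)^-1 * z.2) +
     H i j (c * (B * n%:R)^-1 * z.1) (c * (B * n%:R)^-1 * z.2)))).
  by near: z.
rewrite -mulrA ler_pM2l// ler_pdivrMl// mulrDr; apply: lerD.
  apply: (@le_trans _ _ (K * A k j z.1 z.2)); first by near: z.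
  by rewrite ler_wpM2r ?jtail_ge0// le_max lexx.
apply: (@le_trans _ _ (K' * A i j z.1 z.2)); first by near: z.
by rewrite ler_wpM2r ?jtail_ge0// le_max lexx orbT.
Unshelve. all: by end_near. Qed.

End extra_jumps.

Section bounded_weights.
Context d (T : measurableType d) (R : realType) (P : probability T R) (n : nat).
Variables Theta Delta X Y : 'I_n -> {RV P >-> R}.
Hypothesis n_gt0 : (0 < n)%N.
Hypotheses (Theta_ge0 : forall i t, 0 <= Theta i t)
           (Delta_ge0 : forall j t, 0 <= Delta j t).
Hypothesis indep : forall i j,
  independent_maps P (pair_map (Theta i) (Delta j)) (pair_map (X i) (Y j)).
Variable B : R.
Hypotheses (B_gt1 : 1 < B)
           (Theta_le : forall i, Pr P [set t | Theta i t > B] = 0)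
           (Delta_le : forall j, Pr P [set t | Delta j t > B] = 0).

Local Notation U := (fun i => Theta i \* X i).
Local Notation V := (fun j => Delta j \* Y j).
Local Notation H i j := (jtail P (X i) (Y j)).
Local Notation A i j := (jtail P (Theta i \* X i) (Delta j \* Y j)).
Local Notation S z := (\sum_(i < n) \sum_(j < n) A i j z.1 z.2).

Hypothesis A_gt0 : forall i j, \forall z \near oo2 R, 0 < A i j z.1 z.2.
Hypothesis H_bounded : forall i j, scale_bounded (H i j).

Let mU i : measurable_fun setT (Theta i \* X i).
Proof. exact: measurable_funM. Qed.

Let mV j : measurable_fun setT (Delta j \* Y j).
Proof. exact: measurable_funM. Qed.

Let A_antitone i j : antitone2 (A i j).
Proof. exact: jtail_antitone. Qed.

Lemma weighted_tail_ge_family i j : exists2 c, 0 < c &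
  \forall z \near oo2 R, c * H i j z.1 z.2 <= A i j z.1 z.2.
Proof.
have [[x y] /= [[x0 y0] Axy]] := filter_ex (filterI (near_oo2_gt 0) (A_gt0 i j)).
exact: (weighted_tail_ge _ _ (indep i j) (H_bounded i j) (ltW x0) (ltW y0)).
Qed.

Let tail_le_A i j b : 0 < b < 1 -> exists2 K, 0 < K &
  \forall z \near oo2 R, H i j (b * z.1) (b * z.2) <= K * A i j z.1 z.2.
Proof.
have [c c0 cHA] := weighted_tail_ge_family i j.
exact: (tail_le_weighted (H_bounded i j) c0 cHA).
Qed.

Let tail_le_A_swap i j b : 0 < b < 1 -> exists2 K, 0 < K &
  \forall z \near oo2 R, jtail P (Y i) (X j) (b * z.1) (b * z.2) <=
    K * jtail P (Delta i \* Y i) (Theta j \* X j) z.1 z.2.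
Proof.
move=> /(tail_le_A j i)[K K0 HK]; exists K => //.
by apply: filterS (near_oo2_swap HK) => z /=; rewrite jtailC [in leRHS]jtailC.
Qed.

Let A_le_S i j z : A i j z.1 z.2 <= S z.
Proof.
rewrite (bigD1 i)//= (bigD1 j)//= -addrA lerDl addr_ge0//.
  by apply: sumr_ge0 => *; exact: jtail_ge0.
by apply: sumr_ge0 => *; apply: sumr_ge0 => *; exact: jtail_ge0.
Qed.

Let S_gt0 : \forall z \near oo2 R, 0 < S z.
Proof.
by apply: filterS (A_gt0 (Ordinal n_gt0) (Ordinal n_gt0)) => z /lt_le_trans; apply.
Qed.

(** The gaps [l] and [m] by which the thresholds may be moved have to be small
    enough not to affect the tails, and large enough for a second term of
    their size to be negligible. *)
Lemma ruin_asymp_of_gaps :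
  (forall e : R, 0 < e -> exists l m : R -> R, [/\
     \forall z \near oo2 R, 0 < l z.1 <= z.1 /\ 0 < m z.2 <= z.2,
     forall i j, \forall z \near oo2 R,
       A i j (z.1 - l z.1) (z.2 - m z.2) <= (1 + e) * A i j z.1 z.2 /\
       A i j z.1 z.2 <= (1 + e) * A i j (z.1 + l z.1) (z.2 + m z.2),
     forall i k j, k != i -> \forall z \near oo2 R,
       Pr P (extra_jump U V (l z.1 / n%:R) (z.1 / n%:R) (z.2 / n%:R) i k j)
         <= e * S z &
     forall i k j, k != i -> \forall z \near oo2 R,
       Pr P (extra_jump V U (m z.2 / n%:R) (z.2 / n%:R) (z.1 / n%:R) i k j)
         <= e * S z]) ->
  asymp_equiv (oo2 R) (fun z => psi_and P Theta Delta X Y z.1 z.2)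
    (fun z => S z).
Proof.
move=> gaps; apply: asymp_equiv_squeeze => // e e0.
pose N : R := (#|{: 'I_n * 'I_n * 'I_n}| * 2)%:R.
pose M : R := #|{: 'I_n * 'I_n}|%:R.
have N0 : 0 <= N by exact: ler0n.
have MN0 : 0 <= M * N by rewrite mulr_ge0.
have D0 : 0 < 1 + N + M * N by rewrite -addrA ltr_pwDl// addr_ge0.
pose e1 := e / (1 + N + M * N).
have e10 : 0 < e1 by rewrite divr_gt0.
have e1E : e1 * (1 + N + M * N) = e by rewrite divfK ?gt_eqF.
have [l [m [lm insens badU badV]]] := gaps e1 e10.
have {}insens : \forall z \near oo2 R, forall p : 'I_n * 'I_n,
    A p.1 p.2 (z.1 - l z.1) (z.2 - m z.2) <= (1 + e1) * A p.1 p.2 z.1 z.2 /\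
    A p.1 p.2 z.1 z.2 <= (1 + e1) * A p.1 p.2 (z.1 + l z.1) (z.2 + m z.2).
  by apply: filter_forall => p; exact: insens.
have {}badU : \forall z \near oo2 R, forall p : 'I_n * 'I_n * 'I_n,
    p.1.2 != p.1.1 -> Pr P (extra_jump U V (l z.1 / n%:R) (z.1 / n%:R)
      (z.2 / n%:R) p.1.1 p.1.2 p.2) <= e1 * S z.
  apply: filter_forall => p; have [->|pN] := eqVneq p.1.2 p.1.1; first exact: nearW.
  by apply: filterS (badU _ _ p.2 pN).
have {}badV : \forall z \near oo2 R, forall p : 'I_n * 'I_n * 'I_n,
    p.1.2 != p.1.1 -> Pr P (extra_jump V U (m z.2 / n%:R) (z.2 / n%:R)
      (z.1 / n%:R) p.1.1 p.1.2 p.2) <= e1 * S z.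
  apply: filter_forall => p; have [->|pN] := eqVneq p.1.2 p.1.1; first exact: nearW.
  by apply: filterS (badV _ _ p.2 pN).
near=> z.
have [lz mz] : 0 < l z.1 <= z.1 /\ 0 < m z.2 <= z.2 by near: z.
have S0 : 0 < S z by near: z.
have ins : forall p : 'I_n * 'I_n,
    A p.1 p.2 (z.1 - l z.1) (z.2 - m z.2) <= (1 + e1) * A p.1 p.2 z.1 z.2 /\
    A p.1 p.2 z.1 z.2 <= (1 + e1) * A p.1 p.2 (z.1 + l z.1) (z.2 + m z.2).
  by near: z.
have eS0 : 0 <= e1 * S z by rewrite mulr_ge0// ltW.
have bU : forall p : 'I_n * 'I_n * 'I_n,
    p.1.2 != p.1.1 -> Pr P (extra_jump U V (l z.1 / n%:R) (z.1 / n%:R)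
      (z.2 / n%:R) p.1.1 p.1.2 p.2) <= e1 * S z by near: z.
have bV : forall p : 'I_n * 'I_n * 'I_n,
    p.1.2 != p.1.1 -> Pr P (extra_jump V U (m z.2 / n%:R) (z.2 / n%:R)
      (z.1 / n%:R) p.1.1 p.1.2 p.2) <= e1 * S z by near: z.
have [] := @ruin_event_bounds _ _ _ P n U V mU mV _ _ _ _ _ lz mz eS0
  (fun i k j => bU (i, k, j)) (fun i k j => bV (i, k, j)).
rewrite psi_andE -/(ruin_event U V z.1 z.2) -/N -/M.
move: (Pr P _) => p.
set Qm := \sum_i \sum_j A i j (z.1 - l z.1) _.
set Qp := \sum_i \sum_j A i j (z.1 + l z.1) _ => up low.
have Qm_le : Qm <= (1 + e1) * S z.
  rewrite /Qm mulr_sumr; apply: ler_sum => i _; rewrite mulr_sumr.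
  by apply: ler_sum => j _; have [] := ins (i, j).
have Qp_ge : S z <= (1 + e1) * Qp.
  rewrite /Qp mulr_sumr; apply: ler_sum => i _; rewrite mulr_sumr.
  by apply: ler_sum => j _; have [] := ins (i, j).
have Qp_le : e1 * Qp <= e1 * S z.
  rewrite ler_pM2l//; apply: ler_sum => i _; apply: ler_sum => j _.
  by apply: A_antitone; rewrite lerDl; [case/andP: lz|case/andP: mz] => /ltW.
have NeS : 0 <= N * (e1 * S z) by rewrite mulr_ge0.
have MNeS : 0 <= M * (N * (e1 * S z)) by rewrite mulrA mulr_ge0.
rewrite -e1E; apply/andP; split.
  have -> : (1 - e1 * (1 + N + M * N)) * S z =
    S z - e1 * S z - N * (e1 * S z) - M * (N * (e1 * S z)) by ring.
  move: Qp_ge; rewrite mulrDl mul1r; lra.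
have -> : (1 + e1 * (1 + N + M * N)) * S z =
    (1 + e1) * S z + N * (e1 * S z) + M * (N * (e1 * S z)) by ring.
lra.
Unshelve. all: by end_near. Qed.

(** A constant gap suffices when the thresholds of the components may tend to
    infinity at unrelated rates. *)
Lemma ruin_asymp_GTAI : GTAI P X Y ->
  (forall i j, shift_insensitive (H i j)) ->
  asymp_equiv (oo2 R) (fun z => psi_and P Theta Delta X Y z.1 z.2)
    (fun z => S z).
Proof.
move=> [gXY gYX] iH; apply: ruin_asymp_of_gaps => e e0.
have bad1 i k j : k != i -> \forall L \near +oo, \forall z \near oo2 R,
    Pr P (extra_jump U V (L / n%:R) (z.1 / n%:R) (z.2 / n%:R) i k j) <= e * S z.
  move=> ki; have := extra_jump_GTAI_le n_gt0 Theta_ge0 Delta_ge0 B_gt1 Theta_le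
    Delta_le tail_le_A j gXY ki e0.
  apply: filterS => L; apply: filterS => z /le_trans; apply.
  by rewrite ler_pM2l.
have bad2 i k j : k != i -> \forall L \near +oo, \forall z \near oo2 R,
    Pr P (extra_jump V U (L / n%:R) (z.2 / n%:R) (z.1 / n%:R) i k j) <= e * S z.
  move=> ki; have := extra_jump_GTAI_le n_gt0 Delta_ge0 Theta_ge0 B_gt1 Delta_le
    Theta_le tail_le_A_swap j gYX ki e0.
  apply: filterS => L /near_oo2_swap; apply: filterS => z /= /le_trans; apply.
  by rewrite jtailC ler_pM2l.
have bad1' : \forall L \near +oo, forall p : 'I_n * 'I_n * 'I_n, p.1.2 != p.1.1 ->
    \forall z \near oo2 R, Pr P (extra_jump U V (L / n%:R) (z.1 / n%:R)
      (z.2 / n%:R) p.1.1 p.1.2 p.2) <= e * S z.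
  apply: filter_forall => p; have [->|pN] := eqVneq p.1.2 p.1.1; first exact: nearW.
  by apply: filterS (bad1 _ _ p.2 pN).
have bad2' : \forall L \near +oo, forall p : 'I_n * 'I_n * 'I_n, p.1.2 != p.1.1 ->
    \forall z \near oo2 R, Pr P (extra_jump V U (L / n%:R) (z.2 / n%:R)
      (z.1 / n%:R) p.1.1 p.1.2 p.2) <= e * S z.
  apply: filter_forall => p; have [->|pN] := eqVneq p.1.2 p.1.1; first exact: nearW.
  by apply: filterS (bad2 _ _ p.2 pN).
have [L [L0 [bL1 bL2]]] := filter_ex (filterI (nbhs_pinfty_gt (num_real (0 : R)))
  (filterI bad1' bad2')).
exists (fun=> L), (fun=> L); split.
- by apply: filterS (near_oo2_gt L) => z [? ?]; rewrite L0 !ltW.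
- move=> i j; have [c c0 cHA] := weighted_tail_ge_family i j.
  have iA := weighted_shift_insensitive (Theta_ge0 i) (Delta_ge0 j) (indep i j)
    B_gt1 (Theta_le i) (Delta_le j) (H_bounded i j) c0 cHA (iH i j).
  have A1 := iA e L e0 (ltW L0).
  have LL : x + L @[x --> +oo] --> +oo.
    by have := shift_cvgy (- L); under eq_fun do rewrite opprK.
  have A2 := near_oo2_comp LL LL A1.
  by apply: filterS2 A1 A2 => z /= ?; rewrite !addrK.
- by move=> i k j ki; exact: (bL1 (i, k, j)).
- by move=> i k j ki; exact: (bL2 (i, k, j)).
Unshelve. all: by end_near. Qed.

(** With a common threshold for the two terms of a line, a second jump is only
    known to be negligible if its size is proportional to the threshold, and so
    is the gap. *)
Lemma ruin_asymp_GQAI : GQAI P X Y ->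
  (forall i j, scale_insensitive (H i j)) ->
  asymp_equiv (oo2 R) (fun z => psi_and P Theta Delta X Y z.1 z.2)
    (fun z => S z).
Proof.
move=> [gX gY] iH; apply: ruin_asymp_of_gaps => e e0.
have iA : exists2 c : R, 0 < c < 1 & forall i j, \forall z \near oo2 R,
    A i j (c * z.1) (c * z.2) <= (1 + e) * A i j z.1 z.2.
  have ex (p : 'I_n * 'I_n) : exists c : R, 0 < c < 1 /\ \forall z \near oo2 R,
      A p.1 p.2 (c * z.1) (c * z.2) <= (1 + e) * A p.1 p.2 z.1 z.2.
    have [c c0 cHA] := weighted_tail_ge_family p.1 p.2.
    have [k k01 Hk] := weighted_scale_insensitive (Theta_ge0 p.1) (Delta_ge0 p.2)
      (indep p.1 p.2) B_gt1 (Theta_le p.1) (Delta_le p.2) (iH p.1 p.2) e0.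
    by exists k.
  have [f fP] := choice ex.
  (* By monotonicity the largest of these factors suits all pairs; the default
     [2^-1] keeps it positive. *)
  have f1 : \big[Num.max/2^-1]_p f p < 1.
    rewrite bigmax_lt// ?invf_lt1 ?ltr1n// => p _.
    by have [/andP[]] := fP p.
  have f0 : 0 < \big[Num.max/2^-1]_p f p.
    by apply: (@lt_le_trans _ _ 2^-1); [rewrite invr_gt0|exact: bigmax_ge_id].
  exists (\big[Num.max/2^-1]_p f p); first by rewrite f0.
  move=> i j; have [_ fij] := fP (i, j); near=> z.
  have [z1 z2] : 0 < z.1 /\ 0 < z.2 by near: z; exact: near_oo2_gt.
  apply: (@le_trans _ _ (A i j (f (i, j) * z.1) (f (i, j) * z.2))); last by near: z.
  by apply: A_antitone; rewrite ler_pM2r// (le_bigmax _ f (i, j)).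
have [c /andP[c0 c1] Hc] := iA.
have c01 : 0 < 1 - c < 1 by apply/andP; split; lra.
have e2 : 0 < e / 2 by rewrite divr_gt0.
exists (fun x => (1 - c) * x), (fun y => (1 - c) * y); split.
- apply: filterS (near_oo2_gt 0) => z [z1 z2].
  have /andP[c'0 c'1] := c01.
  by rewrite !mulr_gt0//= !ler_piMl// ltW.
- move=> i j; have c'_cvgy : c^-1 * x @[x --> +oo] --> +oo.
    by apply: scale_cvgy; rewrite invr_gt0.
  have Hc' := near_oo2_comp c'_cvgy c'_cvgy (Hc i j).
  near=> z; have [z1 z2] : 0 < z.1 /\ 0 < z.2 by near: z; exact: near_oo2_gt.
  split.
    have sub x : x - (1 - c) * x = c * x by ring.
    by rewrite !sub; near: z; exact: Hc.
  apply: (@le_trans _ _ ((1 + e) * A i j (c^-1 * z.1) (c^-1 * z.2))).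
    have cc x : c * (c^-1 * x) = x by rewrite mulrA mulfV ?mul1r// gt_eqF.
    rewrite -{1}(cc z.1) -{1}(cc z.2); near: z; exact: Hc'.
  have up x : 0 < x -> x + (1 - c) * x <= c^-1 * x.
    move=> x0; rewrite -[X in X + _]mul1r -mulrDl ler_pM2r// -[leRHS]mul1r.
    rewrite ler_pdivlMr//; have : 0 <= (1 - c) ^+ 2 by exact: sqr_ge0.
    by rewrite expr2; lra.
  rewrite ler_pM2l; last by rewrite addr_gt0.
  by apply: A_antitone; exact: up.
- move=> i k j ki.
  have gX' e' : 0 < e' -> \forall z \near oo2 R,
      Pr P (extra_jump X Y z.1 z.1 z.2 i k j) <=
      e' * (H k j z.1 z.2 + H i j z.1 z.2).
    by move=> e'0; exact: ratio_cvg_le (gX k i j ki) e'0.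
  have := extra_jump_GQAI_le n_gt0 Theta_ge0 Delta_ge0 B_gt1 Theta_le
    Delta_le tail_le_A gX' c01 e2.
  apply: filterS => z /le_trans; apply.
  have := A_le_S k j z; have := A_le_S i j z.
  by rewrite -mulrA ler_pM2l//; lra.
- move=> i k j ki.
  have gY' e' : 0 < e' -> \forall z \near oo2 R,
      Pr P (extra_jump Y X z.1 z.1 z.2 i k j) <=
      e' * (jtail P (Y k) (X j) z.1 z.2 + jtail P (Y i) (X j) z.1 z.2).
    move=> e'0; have HY : \forall z \near oo2 R,
        Pr P (extra_jump Y X z.2 z.2 z.1 i k j) <=
        e' * (H j k z.1 z.2 + H j i z.1 z.2).
      exact: ratio_cvg_le (gY j i k ki) e'0.
    have {}HY := near_oo2_swap HY; near=> z.
    by rewrite jtailC [X in _ + X]jtailC; near: z; exact: HY.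
  have HY := extra_jump_GQAI_le n_gt0 Delta_ge0 Theta_ge0 B_gt1
    Delta_le Theta_le tail_le_A_swap gY' c01 e2.
  have {}HY := near_oo2_swap HY; near=> z.
  have /le_trans : Pr P (extra_jump V U ((1 - c) * z.2 / n%:R) (z.2 / n%:R)
      (z.1 / n%:R) i k j) <= e / 2 * (jtail P (V k) (U j) z.2 z.1 +
      jtail P (V i) (U j) z.2 z.1) by near: z; exact: HY.
  apply.
  rewrite jtailC [X in _ + X]jtailC.
  have := A_le_S j k z; have := A_le_S j i z.
  by rewrite -mulrA ler_pM2l//; lra.
Unshelve. all: by end_near. Qed.

End bounded_weights.

(** * Boundedness of the weights and independence of pairs *)

Section assumptions.
Context d (T : measurableType d) (R : realType) (P : probability T R) (n : nat).
Variables Theta Delta X Y : 'I_n -> {RV P >-> R}.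

(** Fix [x] large and let [y] tend to infinity: the left-hand side does not
    depend on [y], while the joint tail tends to 0. *)
Lemma weight_bounded (Z U V : T -> R) (b : R -> R) :
  measurable_fun setT Z -> measurable_fun setT U -> measurable_fun setT V ->
  (\forall z \near oo2 R, Pr P [set t | Z t > b z.1] <= jtail P U V z.1 z.2) ->
  exists B, Pr P [set t | Z t > B] = 0.
Proof.
move=> mZ mU mV /near_oo2P[M M0 HM]; exists (b (M + 1)).
apply/eqP; rewrite eq_le Pr_ge0 andbT; apply/ler_addgt0Pr => e e0; rewrite add0r.
have [y [My Vy]] := filter_ex (filterI (nbhs_pinfty_gt (num_real M))
  (Pr_gt_cvg0 P mV e0)).
apply: le_trans (HM (M + 1) y _ My) _; first by rewrite ltrDl.
apply: le_trans (ltW Vy); apply: Pr_le; last by move=> t [].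
  exact: measurable_jgt.
exact: measurable_gt.
Qed.

Lemma assumption_A_bounded : assumption_A P Theta Delta X Y ->
  exists B, [/\ 1 < B, forall i, Pr P [set t | Theta i t > B] = 0 &
    forall j, Pr P [set t | Delta j t > B] = 0].
Proof.
move=> [b [c [_ _ bc]]].
have mprod (Z W : {RV P >-> R}) : measurable_fun setT (Z \* W).
  exact: measurable_funM.
have exTh i : exists B, Pr P [set t | Theta i t > B] = 0.
  have [Tb _] := bc i i.
  have Hb : \forall z \near oo2 R, tail P (Theta i) (b i z.1) <=
      1 * jtail P (Theta i \* X i) (Delta i \* Y i) z.1 z.2.
    exact: ratio_cvg_le Tb ltr01.
  apply: (@weight_bounded _ (Theta i \* X i) (Delta i \* Y i) (b i)) => //.
  by apply: filterS Hb => z; rewrite tailE mul1r.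
have exDe j : exists B, Pr P [set t | Delta j t > B] = 0.
  have [_ Tc] := bc j j.
  have Hc : \forall z \near oo2 R, tail P (Delta j) (c j z.2) <=
      1 * jtail P (Theta j \* X j) (Delta j \* Y j) z.1 z.2.
    exact: ratio_cvg_le Tc ltr01.
  apply: (@weight_bounded _ (Delta j \* Y j) (Theta j \* X j) (c j)) => //.
  have {}Hc := near_oo2_swap Hc.
  by apply: filterS Hc => z /=; rewrite tailE mul1r jtailC.
have [f fP] := choice exTh; have [g gP] := choice exDe.
exists (\big[Num.max/2]_i Num.max (f i) (g i)).
have le0 (Z : {RV P >-> R}) u w : u <= w -> Pr P [set t | Z t > u] = 0 ->
    Pr P [set t | Z t > w] = 0.
  move=> uw Z0; apply/eqP; rewrite eq_le Pr_ge0 andbT -Z0.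
  by apply: Pr_le; [exact: measurable_gt..|move=> t /=; exact: le_lt_trans].
split.
- by apply: (@lt_le_trans _ _ 2); [rewrite ltr1n|exact: bigmax_ge_id].
- move=> i; apply: le0 (fP i); apply: le_trans (le_bigmax _ _ i).
  by rewrite le_max lexx.
- move=> j; apply: le0 (gP j); apply: le_trans (le_bigmax _ _ j).
  by rewrite le_max lexx orbT.
Qed.

Lemma assumption_A_gt0 i j : assumption_A P Theta Delta X Y ->
  \forall z \near oo2 R, 0 < jtail P (Theta i \* X i) (Delta j \* Y j) z.1 z.2.
Proof. by move=> [b [c [_ _ /(_ i j)[[]]]]]. Qed.

Lemma independent_vectors_pairs : independent_vectors P Theta Delta X Y ->
  forall i j,
    independent_maps P (pair_map (Theta i) (Delta j)) (pair_map (X i) (Y j)).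
Proof.
move=> ind i j A B mA mB.
pose sel (v : n.-tuple R * n.-tuple R) := (tnth v.1 i, tnth v.2 j).
have msel : measurable_fun setT sel.
  apply: measurable_fun_pair.
    by apply: measurableT_comp (measurable_tnth i) _; exact: measurable_fst.
  by apply: measurableT_comp (measurable_tnth j) _; exact: measurable_snd.
have selP (Z W : 'I_n -> {RV P >-> R}) C :
    joint_vector Z W @^-1` (sel @^-1` C) = pair_map (Z i) (W j) @^-1` C.
  by apply/seteqP; split=> t; rewrite /preimage/= /sel/= !tnth_mktuple.
rewrite -!selP ind//.
  by rewrite -[X in measurable X]setTI; exact: msel.
by rewrite -[X in measurable X]setTI; exact: msel.
Qed.

End assumptions.

Theorem corollary5p2 (R : realType) (d : measure_display)
    (T : measurableType d) (P : probability T R) (n : nat)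
    (X Y Theta Delta : 'I_n -> {RV P >-> R})
    (n_gt0 : (0 < n)%N)
    (X_tail_gt0 : forall i x, 0 < tail P (X i) x)
    (Y_tail_gt0 : forall j y, 0 < tail P (Y j) y)
    (Theta_ge0 : forall i t, 0 <= Theta i t)
    (Delta_ge0 : forall j t, 0 <= Delta j t)
    (Theta_nondeg : forall i, nondegenerate P (Theta i))
    (Delta_nondeg : forall j, nondegenerate P (Delta j))
    (indep : independent_vectors P Theta Delta X Y)
    (assA : assumption_A P Theta Delta X Y) :
  (let K := forall i j, class_C2 P (X i) (Y j) in
   let K' := forall i j, class_DL2 P (X i) (Y j) in
   cond_H1 P X Y K \/ cond_H2 P Theta Delta X Y K' ->
   asymp_equiv (oo2 R)
     (fun z => psi_and P Theta Delta X Y z.1 z.2)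
     (fun z => \sum_(i < n) \sum_(j < n)
        jtail P (Theta i \* X i) (Delta j \* Y j) z.1 z.2))
  /\
  (forall alpha1 alpha2 : 'I_n -> R,
   (forall i, 0 < alpha1 i) -> (forall j, 0 < alpha2 j) ->
   let K := forall i j, class_R2 P (alpha1 i) (alpha2 j) (X i) (Y j) in
   cond_H1 P X Y K \/ cond_H2 P Theta Delta X Y K ->
   (exists2 eps : R, 0 < eps & forall i j,
      ('E_P[fun t => (Theta i t `^ (alpha1 i + eps)
                      * Delta j t `^ (alpha2 j + eps))%R] < +oo)%E) ->
   asymp_equiv (oo2 R)
     (fun z => psi_and P Theta Delta X Y z.1 z.2)
     (fun z => \sum_(i < n) \sum_(j < n)
        fine 'E_P[fun t => (Theta i t `^ alpha1 i * Delta j t `^ alpha2 j)%R]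
        * jtail P (X i) (Y j) z.1 z.2)).
Proof.
have [B [B1 ThB DeB]] := assumption_A_bounded assA.
have A_gt0 i j := assumption_A_gt0 i j assA.
have ind := independent_vectors_pairs indep.
have anti i j : antitone2 (jtail P (X i) (Y j)) by exact: jtail_antitone.
split=> [K K' H12|alpha1 alpha2 alpha1_gt0 alpha2_gt0 K H12 _].
  case: H12 => [[gqai C2]|[gtai _ DL2 _ _]].
    have iH i j := class_C2_scale_insensitive (C2 i j).
    apply: (ruin_asymp_GQAI n_gt0 Theta_ge0 Delta_ge0 ind B1) => // i j.
    exact: scale_insensitive_bounded.
  apply: (ruin_asymp_GTAI n_gt0 Theta_ge0 Delta_ge0 ind B1) => // i j.
    by apply: class_D2_scale_bounded; have [] := DL2 i j.
  by apply: class_L2_shift_insensitive; have [] := DL2 i j.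
have RV : forall i j, class_R2 P (alpha1 i) (alpha2 j) (X i) (Y j).
  by case: H12 => [[]|[]].
have iH i j := class_R2_scale_insensitive (alpha1_gt0 i) (alpha2_gt0 j) (RV i j).
have bH i j := scale_insensitive_bounded (anti i j) (iH i j).
apply: asymp_equiv_trans (_ : asymp_equiv _ _ (fun z => \sum_(i < n) \sum_(j < n)
    jtail P (Theta i \* X i) (Delta j \* Y j) z.1 z.2)) _.
  case: H12 => [[gqai _]|[gtai _ _ _ _]].
    exact: (ruin_asymp_GQAI n_gt0 Theta_ge0 Delta_ge0 ind B1).
  apply: (ruin_asymp_GTAI n_gt0 Theta_ge0 Delta_ge0 ind B1) => // i j.
  exact: scale_insensitive_shift.
apply: (asymp_equiv_sum (Ordinal n_gt0)) => i.
apply: (asymp_equiv_sum (Ordinal n_gt0)) => j.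
have [c c0 cHA] := weighted_tail_ge_family Theta_ge0 Delta_ge0 ind A_gt0 bH i j.
exact: (weighted_tail_breiman (Theta_ge0 i) (Delta_ge0 j) (ind i j) B1
  (ThB i) (DeB j) (alpha1_gt0 i) (alpha2_gt0 j) (RV i j) c0 cHA).
Qed.
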